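(* Let $\ell$ be a positive integer divisible by $12$ and let $k$ be the smallest integer greater than $2$ that does not divide $\ell$. There exists $n_0 = n_0(\ell)$ such that every oriented graph $H$ on $n \ge n_0$ vertices with $\delta^\pm(H) \ge \frac{n}{k}\left(1 - \frac{1}{30k}\right)$ that contains no closed walk of length $\ell$ is homomorphic to $C_k$.
   Context: An oriented graph is a finite directed graph without loops and without multiple edges regardless of direction (at most one of $uw$, $wu$ is an edge). $\delta^\pm(H)$, the minimum semidegree, is the minimum of the minimum outdegree and the minimum indegree of $H$. Walks are directed walks; a walk of length $\ell$ has $\ell$ edges (counted with repetition). $C_k$ is the directed cycle of length $k$. A graph $F$ is homomorphic to a graph $H$ if there is a map $f: V(F) \to V(H)$ such that $uv \in E(F)$ implies $f(u)f(v) \in E(H)$. *)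

(* Defs.v *)
From mathcomp Require Import all_boot all_order all_algebra.
Set Implicit Arguments. Unset Strict Implicit. Unset Printing Implicit Defensive.

(* A finite directed graph without multiple edges is a relation [e : rel T] on
   a finite type [T]; [e u v] means that uv is an edge. *)

Definition oriented (T : finType) (e : rel T) : Prop :=
  irreflexive e /\ forall u w : T, ~~ (e u w && e w u).

Definition outdegree (T : finType) (e : rel T) (v : T) : nat :=
  #|[set w | e v w]|.

Definition indegree (T : finType) (e : rel T) (v : T) : nat :=
  #|[set w | e w v]|.

(* No degree exceeds [#|T|], so this default value does not affect the minimum
   as soon as there is a vertex. *)
Definition min_semidegree (T : finType) (e : rel T) : nat :=
  minn (\big[minn/#|T|]_(v : T) outdegree e v)
       (\big[minn/#|T|]_(v : T) indegree e v).

(* The walk x = x_0, x_1, ..., x_l has vertex sequence [x :: p], hence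
   [size p] edges; vertices and edges may repeat. *)
Definition has_closed_walk (T : finType) (e : rel T) (l : nat) : Prop :=
  exists (x : T) (p : seq T), [/\ path e x p, size p = l & last x p = x].

(* [ordS] is the successor modulo k on [{0, ..., k-1}]. *)
Definition dicycle (k : nat) : rel 'I_k := [rel i j | j == ordS i].
Arguments dicycle : clear implicits.

Definition homomorphic (T U : finType) (e : rel T) (e' : rel U) : Prop :=
  exists f : T -> U, forall u v : T, e u v -> e' (f u) (f v).

Definition smallest_nondivisor_gt2 (l k : nat) : Prop :=
  [/\ 2 < k, ~~ (k %| l) & forall j : nat, 2 < j -> ~~ (j %| l) -> k <= j].

(* Main.v *)
Require Import Defs.
From mathcomp Require Import all_boot all_order all_algebra zify ring.

(** Write [n] for the number of vertices and [d] for the minimum semidegree, so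
that [n] is only slightly larger than [k * d].  Since every number below [k]
divides [l], the digraph has no closed walk shorter than [k].  The aim is to show
that walks join any two vertices and that [k] divides the length of every closed
walk; the distance from a fixed vertex, modulo [k], is then a homomorphism to the
cycle ([homomorphic_periodic]).

The tool is growth of balls.  A lower bound on the girth makes every nonempty set
[S] contain a vertex with at most [(p / q) * #|S|] successors in [S] ([sparse]).
Averaging gives the ratio 1/2 for girth three, counting transitive triangles gives
5/14 and 7/24 for girth four and five, and a contraction ([sparse_contract]) raises
the girth by two at the price of adding one to [q / p].  The closed neighbourhood of
[S] then has at least [(1 - p / q) * #|S| + d] vertices, so balls soon fill half of
the digraph and any two vertices are joined by short walks.

If [k >= 8], then [l] is large compared with the lengths of these walks.  The girth
[g] lies between [k] and [2 * k - 1], and a short closed walk whose length [g] does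
not divide could be combined with closed walks of length [g] to one of length [l]
([periodic_of_short_walks]).  So [g] is a period, and then [n >= g * d] forces
[g = k].  As [k] is not 6, 10 or 12, this leaves 5 and 7.  There one passes to the
digraph of walks of length [m], where [l = 12 * m] or [l = 60 * m]: degrees do not
decrease, closed walks of length 12 or 60 are excluded, and periodicity passes back
([periodic_power]).

For [k = 7] a shortest closed walk combines with almost every other short closed
walk through the same vertex to one of length 60.  So all arcs lie on shortest closed
walks, and a fixed closed walk of length 7 determines the position of every vertex
([periodic_seven]).

For [k = 5] there is a closed walk of length five ([no_closed_five_absurd]).  Label
a vertex by the positions of its predecessors on it, and similarly for successors.
Excluding the lengths 1, 2, 3, 4, 6, 7 and 12 restricts the patterns of labels of two
vertices joined by a short walk.  Two counting arguments that balance these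
restrictions against the growth of balls show that labels are unique ([weight_le2],
[weight_le1]).  Hence almost all vertices are divided into five layers, each with
about [d] vertices, and the remaining ones are placed by looking at their
neighbours ([periodic_five]). *)

Set Implicit Arguments.
Unset Strict Implicit.
Unset Printing Implicit Defensive.

(** * Walks, girth and growth of balls *)

Section Walks.
Variable T : finType.
Implicit Types (e r : rel T) (S : {set T}).

Fixpoint walk e (j : nat) : rel T := fun x y =>
  if j is i.+1 then [exists z, e x z && walk e i z y] else x == y.

Lemma walkS e j x y :
  walk e j.+1 x y = [exists z, e x z && walk e j z y].
Proof. by []. Qed.

Lemma walk1 e x y : walk e 1 x y = e x y.
Proof.
apply/existsP/idP => [[z /andP[exz /eqP <-]] //|exy].
by exists y; rewrite exy /=.
Qed.

Lemma walkD e i j x y z : walk e i x y -> walk e j y z -> walk e (i + j) x z.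
Proof.
elim: i x => [|i IH] x; first by move=> /= /eqP ->.
move=> /= /existsP[w /andP[exw wwy]] wyz; apply/existsP; exists w.
by rewrite exw IH.
Qed.

Lemma walk_split e i j x z :
  walk e (i + j) x z -> exists2 y, walk e i x y & walk e j y z.
Proof.
elim: i x => [|i IH] x; first by move=> h; exists x; rewrite /=.
rewrite addSn => /existsP[w /andP[exw /IH[y wy yz]]]; exists y => //=.
by apply/existsP; exists w; rewrite exw.
Qed.

Lemma walkM e m j x y : walk (walk e m) j x y = walk e (j * m) x y.
Proof.
elim: j x => [//|j IH] x; rewrite mulSn walkS; apply/existsP/idP.
  by move=> [z /andP[exz hz]]; rewrite IH in hz; apply: walkD exz hz.
by case/walk_split=> z exz; rewrite -IH => wz; exists z; rewrite exz.
Qed.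

Lemma walk_mul e i j x : walk e i x x -> walk e (j * i) x x.
Proof.
move=> w; elim: j => [|j IH]; first by rewrite /= eqxx.
by rewrite mulSn; apply: walkD w IH.
Qed.

Lemma walk_path e j x y :
  walk e j x y <-> exists p, [/\ path e x p, size p = j & last x p = y].
Proof.
split.
  elim: j x => [|j IH] x /=; first by move/eqP=> <-; exists [::].
  by case/existsP=> z /andP[exz /IH[p [hp <- <-]]]; exists (z :: p); rewrite /= exz.
case=> p [hp <- <-] {y j}; elim: p x hp => [|z p IH] x /=; first by rewrite eqxx.
by case/andP=> exz hp; apply/existsP; exists z; rewrite exz IH.
Qed.

Definition rev_rel e : rel T := fun x y => e y x.

Lemma walk_rev e j x y : walk (rev_rel e) j x y = walk e j y x.
Proof.
elim: j x y => [|j IH] x y; first by rewrite /= eq_sym.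
rewrite walkS; apply/existsP/idP => [[z /andP[ezx wyz]]|].
  by rewrite IH in wyz; rewrite -addn1; apply: walkD wyz _; rewrite walk1.
rewrite -addn1 => /walk_split[z wyz]; rewrite walk1 => ezx.
by exists z; rewrite IH wyz andbT.
Qed.

Definition outs e x : {set T} := [set y | e x y].

(** Closed walks rather than cycles: a shortest closed walk is a cycle, so this is
the usual girth. *)
Definition girth_ge g e := forall j x, 0 < j -> j < g -> ~~ walk e j x x.

Lemma girth_ge_rev g e : girth_ge g e -> girth_ge g (rev_rel e).
Proof. by move=> h j x j0 jg; rewrite walk_rev h. Qed.

Lemma girth_geW g g' e : g' <= g -> girth_ge g e -> girth_ge g' e.
Proof. by move=> le h j x j0 jg; apply: h => //; apply: leq_trans jg le. Qed.

Lemma walk_sub r e j x y : subrel r e -> walk r j x y -> walk e j x y.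
Proof.
move=> s; elim: j x => [//|j IH] x /existsP[z /andP[rz /IH wz]].
by rewrite walkS; apply/existsP; exists z; rewrite (s _ _ rz).
Qed.

Lemma girth_ge_sub g r e : subrel r e -> girth_ge g e -> girth_ge g r.
Proof.
move=> s h j x j0 jg; apply: contra (h j x j0 jg); exact: walk_sub.
Qed.

(** Only positive lengths, so that [reach e i x x] witnesses a short closed walk
and a girth bound for [e] carries over to [reach e i]. *)
Definition reach e i : rel T := fun x y => [exists j : 'I_i, walk e j.+1 x y].

Lemma reachP e i x y :
  reflect (exists j, [/\ 0 < j, j <= i & walk e j x y]) (reach e i x y).
Proof.
apply: (iffP existsP) => [[j w]|[[|j] [j0 ji w]] //]; first by exists j.+1.
by exists (Ordinal ji).
Qed.

Lemma reach1 e x y : reach e 1 x y = e x y.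
Proof.
apply/reachP/idP => [[[|[|j]] [] //]|exy]; rewrite ?walk1 //.
by exists 1; rewrite walk1.
Qed.

Lemma reachD e i j x y z : reach e i x y -> reach e j y z -> reach e (i + j) x z.
Proof.
move=> /reachP[a [a0 ai wa]] /reachP[b [b0 bj wb]].
by apply/reachP; exists (a + b); split; [lia|lia|apply: walkD wa wb].
Qed.

Lemma reachW e i i' x y : i <= i' -> reach e i x y -> reach e i' x y.
Proof.
by move=> le /reachP[a [a0 ai wa]]; apply/reachP; exists a; split => //; lia.
Qed.

Lemma reach_rev e i x y : reach (rev_rel e) i x y = reach e i y x.
Proof.
by apply/reachP/reachP => -[j [j0 ji w]]; exists j; move: w; rewrite walk_rev.
Qed.

Lemma walk_reach e i j x y : walk (reach e i) j x y ->
  exists a, [/\ j <= a, a <= j * i & walk e a x y].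
Proof.
elim: j x => [|j IH] x; first by move=> w; exists 0.
case/existsP=> z /andP[/reachP[b [b0 bi wb]] /IH[a [ja aj wa]]].
by exists (b + a); split; [lia|nia|apply: walkD wb wa].
Qed.

Lemma girth_ge_reach g m i e : (m - 1) * i < g -> girth_ge g e -> girth_ge m (reach e i).
Proof.
move=> lt h j x j0 jm; apply/negP=> /walk_reach[a [ja aj wa]].
have : ~~ walk e a x x by apply: h; nia.
by rewrite wa.
Qed.

(** A bound of Caccetta-Haggkvist type, demanded of every induced subdigraph
because it will be applied to balls.  The fraction [p / q] is kept as a pair to
stay within the natural numbers. *)
Definition sparse e p q := forall S, S != set0 ->
  exists2 x, x \in S & q * #|outs e x :&: S| <= p * #|S|.

Definition out_closure e S : {set T} := S :|: \bigcup_(x in S) outs e x.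

(** A sparse vertex of [S] has at least [d - (p / q) * #|S|] successors outside
[S]. *)
Lemma out_closure_grow e p q d S : p <= q -> sparse e p q -> S != set0 ->
  (forall x, x \in S -> d <= #|outs e x|) ->
  (q - p) * #|S| + q * d <= q * #|out_closure e S|.
Proof.
move=> pq B S0 dd; have [x xS le] := B S S0.
have : S :|: outs e x \subset out_closure e S.
  by apply: setUS; apply: (bigcup_sup x).
move/subset_leq_card; have := cardsUI S (outs e x); rewrite setIC.
have := dd x xS; move: le.
set u := #|outs e x :&: S|; set v := #|S :|: outs e x|; set w := #|out_closure e S|.
set s := #|S|; set t := #|outs e x|.
move=> h1 h2 h3 h4.
have h5 : q * v + q * u = q * s + q * t by rewrite -!mulnDr h3.
have h6 : q * v <= q * w by rewrite leq_mul2l h4 orbT.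
have h7 : q * d <= q * t by rewrite leq_mul2l h2 orbT.
have h8 : (q - p) * s + p * s = q * s by rewrite -mulnDl subnK.
lia.
Qed.

Lemma out_closure_reach e i j x :
  out_closure (reach e j) (outs (reach e i) x) \subset outs (reach e (i + j)) x.
Proof.
apply/subsetP=> y; rewrite !inE => /orP[|/bigcupP[z]].
  by apply: reachW; lia.
by rewrite !inE; apply: reachD.
Qed.

(** The ball of radius [i + j] contains the successors, under [reach e j], of the
ball of radius [i]. *)
Lemma reach_grow e p q i j (r1 r2 : nat) : p <= q -> sparse (reach e j) p q ->
  0 < r1 ->
  (forall x, r1 <= #|outs (reach e i) x|) ->
  (forall x, r2 <= #|outs (reach e j) x|) ->
  forall x, (q - p) * r1 + q * r2 <= q * #|outs (reach e (i + j)) x|.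
Proof.
move=> pq B r10 h1 h2 x.
have S0 : outs (reach e i) x != set0 by rewrite -card_gt0; apply: leq_trans r10 (h1 x).
have := out_closure_grow pq B S0 (fun y _ => h2 y).
have := subset_leq_card (out_closure_reach e i j x); have := h1 x.
set a := #|_|; set b := #|out_closure _ _|; set c := #|_| => ha hb hc.
have : (q - p) * r1 <= (q - p) * a by rewrite leq_mul2l ha orbT.
have : q * b <= q * c by rewrite leq_mul2l hb orbT.
lia.
Qed.

Lemma reach_meet e i j x y :
  #|T| < #|outs (reach e i) x| + #|outs (reach (rev_rel e) j) y| ->
  exists a b z, [/\ 0 < a <= i, 0 < b <= j, walk e a x z & walk e b z y].
Proof.
move=> lt; have : (outs (reach e i) x :&: outs (reach (rev_rel e) j) y) != set0.
  rewrite -card_gt0; have := cardsUI (outs (reach e i) x) (outs (reach (rev_rel e) j) y).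
  have : #|outs (reach e i) x :|: outs (reach (rev_rel e) j) y| <= #|T| by apply: max_card.
  lia.
case/set0Pn=> z; rewrite !inE reach_rev => /andP[/reachP[a [a0 ai wa]] /reachP[b [b0 bj wb]]].
by exists a, b, z; rewrite a0 b0 ai bj.
Qed.

End Walks.

(** * Vertices of small relative outdegree *)

Section Sums.
Variable T : finType.
Implicit Types (e : rel T) (S : {set T}).

Lemma card_sum S (P : pred T) : #|[set y in S | P y]| = \sum_(y in S) P y.
Proof.
rewrite -sum1dep_card big_mkcondr /=.
by apply: eq_bigr => y _; case: (P y).
Qed.

Lemma card_outsI e S x : #|outs e x :&: S| = \sum_(y in S) e x y.
Proof. by rewrite -card_sum; apply: eq_card => y; rewrite !inE andbC. Qed.

Lemma sum_asym e S :
  (forall x y, ~~ (e x y && e y x)) ->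
  2 * (\sum_(x in S) \sum_(y in S) e x y) <= #|S| * #|S|.
Proof.
move=> as_e; rewrite mul2n -addnn {2}exchange_big /= -big_split /=.
rewrite -[X in X * _]sum1_card big_distrl /=; apply: leq_sum => x _.
rewrite -big_split /= mul1n -sum1_card; apply: leq_sum => y _.
by have := as_e x y; case: (e x y); case: (e y x).
Qed.

Lemma girth_ge_asym e : girth_ge 3 e -> forall x y, ~~ (e x y && e y x).
Proof.
move=> h x y; apply/negP => /andP[exy eyx].
have /negP := h 2 x isT isT; apply.
by rewrite walkS; apply/existsP; exists y; rewrite exy walk1.
Qed.

(** Averaging: in the absence of digons [S] spans at most [#|S| ^ 2 / 2] arcs. *)
Lemma sparse_girth3 e : girth_ge 3 e -> sparse e 1 2.
Proof.
move=> h S S0; apply/exists_inP/contraT => /exists_inPn hS.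
have := sum_asym S (girth_ge_asym h); rewrite leqNgt => /negP; case.
rewrite big_distrr /= -[X in X * _]sum1_card big_distrl /=.
have [x xS] := set0Pn _ S0.
have lt y : y \in S -> 1 * #|S| < 2 * \sum_(z in S) e y z.
  by move=> yS; have := hS y yS; rewrite card_outsI -ltnNge.
rewrite (bigD1 x xS) /= [X in _ < X](bigD1 x xS) /= -addSn.
by apply: leq_add; [apply: lt|apply: leq_sum => y /andP[yS _]; apply/ltnW/lt].
Qed.

End Sums.

Section Contraction.
Variable T : finType.
Implicit Types (e : rel T) (S : {set T}).

(** Suppose that every vertex of [S] has more than [p / (p + q) * #|S|] successors
in [S], let [d] be the smallest of these numbers, and let [v] have indegree at
least [d].  Delete [v] and its predecessors, and let every vertex with an arc to
a predecessor of [v] jump to all successors of [v].  A closed walk of the new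
digraph becomes at most two steps longer in the old one, so the girth drops by at
most two; the outdegrees are still at least [d] while more than [d] vertices are
gone, against the bound [p / q]. *)
Lemma sparse_contract g p q : 0 < p -> 1 < g ->
  (forall e, girth_ge g e -> sparse e p q) ->
  forall e, girth_ge g.+2 e -> sparse e p (p + q).
Proof.
move=> p0 g1 IH e h S S0.
apply/exists_inP/contraT => /exists_inPn hS.
have {}hS y : y \in S -> p * #|S| < (p + q) * #|outs e y :&: S|.
  by move=> yS; have := hS y yS; rewrite -ltnNge.
have [y0 y0S ymin] : exists2 y0, y0 \in S & forall y, y \in S ->
    #|outs e y0 :&: S| <= #|outs e y :&: S|.
  have [x xS] := set0Pn _ S0.
  by case: (arg_minnP (fun y => #|outs e y :&: S|) xS) => y yS hy; exists y.
set d := #|outs e y0 :&: S| in ymin.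
have d0 : 0 < d by have := hS _ y0S; rewrite -/d lt0n; apply: contraTneq => ->; rewrite muln0.
have dS : p * #|S| < (p + q) * d by apply: hS.
(* A vertex of indegree at least d, by averaging. *)
have [v vS vd] : exists2 v, v \in S & d <= #|outs (rev_rel e) v :&: S|.
  apply/exists_inP/contraT => /exists_inPn hv.
  have : \sum_(x in S) \sum_(y in S) e x y < \sum_(y in S) d.
    rewrite exchange_big /= (bigD1 y0 y0S) /= [X in _ < X](bigD1 y0 y0S) /= -addSn.
    have lt y : y \in S -> \sum_(x in S) e x y < d.
      by move=> yS; have := hv y yS; rewrite card_outsI -ltnNge.
    by apply: leq_add; [apply: lt|apply: leq_sum => y /andP[yS _]; apply/ltnW/lt].
  rewrite ltnNge => /negP; case; apply: leq_sum => x xS.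
  by rewrite -card_outsI; apply: ymin.
pose r := [rel x y | e x y || [exists u in S, e x u && e u v] && e v y].
(* Only the first passage through v and what follows the last one are kept,
   so all the shortcuts together cost two steps. *)
have rw j x y : walk r j x y -> walk e j x y \/
    exists a b, [/\ 0 < a, 0 < b, a + b <= j.+2, walk e a x v & walk e b v y].
  elim: j y => [|j IHj] y; first by left.
  rewrite -addn1 => /walk_split[z /IHj hz]; rewrite walk1 /= => /orP[ezy|].
    case: hz => [w|[a [b [a0 b0 ab wa wb]]]].
      by left; apply: walkD w _; rewrite walk1.
    right; exists a, (b + 1); split => //; [lia|lia|].
    by apply: walkD wb _; rewrite walk1.
  case/andP=> /exists_inP[u uS /andP[ezu euv]] evy; right.
  case: hz => [w|[a [b [a0 b0 ab wa wb]]]].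
    exists (j + 2), 1; split; rewrite ?walk1 //; [lia|lia|].
    apply: walkD w _; rewrite walkS; apply/existsP; exists u.
    by rewrite ezu walk1.
  by exists a, 1; split; rewrite ?walk1 //; lia.
have hr : girth_ge g r.
  move=> j x j0 jg; apply/negP => /rw[w|[a [b [a0 b0 ab wa wb]]]].
    by have /negP := h j x j0 ltac:(lia); apply.
  by have /negP := h (a + b) x ltac:(lia) ltac:(lia); apply; apply: walkD wa wb.
pose S' := S :\: (v |: outs (rev_rel e) v).
have nvv : ~~ e v v by have := h 1 v isT isT; rewrite walk1.
have sub : outs e v :&: S \subset S'.
  apply/subsetP=> y; rewrite !inE negb_or => /andP[evy yS]; rewrite yS andbT /rev_rel.
  apply/andP; split; first by apply/eqP => yv; rewrite yv (negPf nvv) in evy.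
  apply/negP=> eyv; have /negP := h 2 v isT ltac:(lia); apply.
  by rewrite walkS; apply/existsP; exists y; rewrite evy walk1.
have S'0 : S' != set0.
  rewrite -card_gt0; apply: leq_trans (subset_leq_card sub).
  by apply: leq_trans d0 _; apply: ymin.
have cS : #|S'| + d.+1 <= #|S|.
  rewrite -(cardsID (v |: outs (rev_rel e) v) S) addnC leq_add2r.
  have -> : S :&: (v |: outs (rev_rel e) v) = v |: (outs (rev_rel e) v :&: S).
    by apply/setP=> y; rewrite !inE; case: eqP => [->|]; rewrite ?vS //= andbC.
  by rewrite cardsU1 !inE /rev_rel (negPf nvv) add1n ltnS.
have [x xS' le] := IH r hr S' S'0.
have xS : x \in S by move: xS'; rewrite inE => /andP[].
have : d <= #|outs r x :&: S'|.
  case: (boolP [exists u in S, e x u && e u v]) => [hu|].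
    apply: leq_trans (ymin v vS) _; apply: subset_leq_card.
    apply/subsetP=> y hy; rewrite inE (subsetP sub y hy) andbT inE /= hu /=.
    by move: hy; rewrite !inE => /andP[-> _]; rewrite orbT.
  move=> /exists_inPn hu; apply: leq_trans (ymin x xS) _; apply: subset_leq_card.
  apply/subsetP=> y; rewrite !inE /= => /andP[exy yS]; rewrite exy yS /= andbT negb_or.
  apply/andP; split.
    by move: xS'; rewrite !inE negb_or /rev_rel -andbA => /and3P[_ nxv _];
       apply: contraNneq nxv => <-.
  by apply/negP; rewrite /rev_rel => eyv; have := hu y yS; rewrite exy eyv.
nia.
Qed.
End Contraction.

Section Shen.
Variable T : finType.
Implicit Types (e : rel T) (S : {set T}).

Lemma subset_of_card d S : d <= #|S| -> exists2 B : {set T}, B \subset S & #|B| = d.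
Proof.
move=> dS; exists [set:: take d (enum S)].
  by apply/subsetP=> x; rewrite inE => /mem_take; rewrite mem_enum.
have -> : #|[set:: take d (enum S)]| = #|take d (enum S)|.
  by apply: eq_card => x; rewrite inE.
by rewrite (card_uniqP _) ?take_uniq ?enum_uniq // size_takel // -cardE.
Qed.

Lemma card_outs e x : #|outs e x| = \sum_y e x y.
Proof. by rewrite -[outs e x]setIT card_outsI; apply: eq_bigl => y; rewrite inE. Qed.

(** Sum the hypothesis over all arcs.  The common successors and the common
predecessors of the two ends both sum to the number of transitive triangles,
which is at most [#|S| * d ^ 2 / 2] as the successors of a vertex span at most
[d ^ 2 / 2] arcs.  The indegrees of the heads sum to a sum of squares, at least
[#|S| * d ^ 2] by Cauchy-Schwarz. *)
Lemma arc_count (E : rel T) S (a b c d : nat) :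
  (forall u v, E u v -> (u \in S) && (v \in S)) ->
  (forall u, u \in S -> \sum_v E u v = d) ->
  (forall x y, ~~ (E x y && E y x)) ->
  0 < d -> S != set0 -> b <= c ->
  (forall u v, E u v ->
     a * d + b * (\sum_z E u z * E v z) + c * (\sum_w E w v + \sum_w E w u)
     <= c * #|S| + c * (\sum_w E w u * E w v)) ->
  (2 * a + 3 * c + b) * d <= 2 * c * #|S|.
Proof.
move=> ES Ed Ea d0 S0 bc H.
set n := #|S| in H *; have n0 : 0 < n by rewrite card_gt0.
pose I v := \sum_w E w v.
have I0 v : v \notin S -> I v = 0.
  move=> vS; apply: big1 => w _; case: (boolP (E w v)) => // /ES.
  by rewrite (negPf vS) andbF.
have E0 u : u \notin S -> \sum_v E u v = 0.
  move=> uS; apply: big1 => v _; case: (boolP (E u v)) => // /ES.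
  by rewrite (negPf uS).
pose T3 := \sum_u \sum_v E u v * (\sum_z E u z * E v z).
have m_eq : \sum_u \sum_v E u v = n * d.
  rewrite (bigID (mem S)) /= [X in _ + X]big1 ?addn0; last by move=> u /E0.
  by rewrite (eq_bigr (fun=> d)) // sum_nat_const.
have m_eq' : \sum_v I v = n * d by rewrite -m_eq exchange_big.
have sq : n * d * d <= \sum_v I v * I v.
  have : \sum_v 2 * d * I v <= \sum_v (I v * I v + (v \in S) * (d * d)).
    apply: leq_sum => v _; case: (boolP (v \in S)) => [_|/I0 ->]; last by rewrite muln0.
    have [+ _] := nat_Cauchy (I v) d.
    by rewrite -!mulnn mul1n -mulnA (mulnC d).
  rewrite big_split /= -big_distrr /= m_eq'.
  have -> : \sum_v (v \in S) * (d * d) = n * (d * d).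
    rewrite -big_distrl /= /n -sum1_card [in RHS]big_mkcond /=.
    by congr (_ * _); apply: eq_bigr => v _; case: (v \in S).
  nia.
have t3 : 2 * T3 <= n * d * d.
  have -> : n * d * d = \sum_(u in S) d * d by rewrite sum_nat_const mulnA.
  rewrite /T3 big_distrr /= [X in _ <= X]big_mkcond /=; apply: leq_sum => u _.
  have -> : \sum_v E u v * (\sum_z E u z * E v z) =
            \sum_(v in outs E u) \sum_(z in outs E u) E v z.
    rewrite [RHS]big_mkcond /=; apply: eq_bigr => v _; rewrite inE.
    case: (E u v); rewrite ?mul1n // [RHS]big_mkcond /=; apply: eq_bigr => z _.
    by rewrite inE; case: (E u z); rewrite ?mul1n.
  apply: leq_trans (sum_asym _ Ea) _; rewrite card_outs.
  by case: (boolP (u \in S)) => [/Ed ->|/E0 ->].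
have t3' : \sum_u \sum_v E u v * (\sum_w E w u * E w v) = T3.
  have -> : \sum_u \sum_v E u v * (\sum_w E w u * E w v) =
            \sum_u \sum_v \sum_w E w u * (E w v * E u v).
    by do 2 (apply: eq_bigr => ? _); rewrite big_distrr /=; apply: eq_bigr => ? _; lia.
  under eq_bigr do rewrite exchange_big /=.
  rewrite exchange_big /=; apply: eq_bigr => u _; apply: eq_bigr => v _.
  by rewrite -big_distrr.
have s1 : \sum_u \sum_v E u v * I v = \sum_v I v * I v.
  by rewrite exchange_big /=; apply: eq_bigr => v _; rewrite -big_distrl.
have s2 : \sum_u \sum_v E u v * I u = n * d * d.
  rewrite -m_eq' big_distrl /=; apply: eq_bigr => u _; rewrite -big_distrl /=.
  by case: (boolP (u \in S)) => [/Ed ->|/I0 ->]; rewrite ?muln0 // mulnC.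
have : \sum_u \sum_v E u v * (a * d + b * (\sum_z E u z * E v z) + c * (I v + I u))
    <= \sum_u \sum_v E u v * (c * n + c * (\sum_w E w u * E w v)).
  apply: leq_sum => u _; apply: leq_sum => v _.
  by case: (boolP (E u v)) => // uv; rewrite !mul1n; apply: H.
have -> : \sum_u \sum_v E u v * (a * d + b * (\sum_z E u z * E v z) + c * (I v + I u))
  = n * d * (a * d) + b * T3 + c * (\sum_v I v * I v + n * d * d).
  rewrite -s1 -s2 -m_eq /T3 -!big_split /= !big_distrl !big_distrr /= -!big_split /=.
  apply: eq_bigr => u _; rewrite -!big_split /= !big_distrl !big_distrr /= -!big_split /=.
  by apply: eq_bigr => v _; lia.
have -> : \sum_u \sum_v E u v * (c * n + c * (\sum_w E w u * E w v))
  = n * d * (c * n) + c * T3.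
  rewrite -t3' -m_eq !big_distrl !big_distrr /= -!big_split /=.
  apply: eq_bigr => u _; rewrite !big_distrl !big_distrr /= -!big_split /=.
  by apply: eq_bigr => v _; lia.
move=> main.
suff : n * d * ((2 * a + 3 * c + b) * d) <= n * d * (2 * c * n).
  by rewrite leq_pmul2l // muln_gt0 n0 d0.
have h : (c - b) * (2 * T3) <= (c - b) * (n * d * d) by rewrite leq_mul2l t3 orbT.
have h' : c * (n * d * d) <= c * (\sum_v I v * I v) by rewrite leq_mul2l sq orbT.
have e1 : (c - b) * (2 * T3) + 2 * (b * T3) = 2 * (c * T3).
  by have := subnK bc; nia.
have e2 : (c - b) * (n * d * d) + b * (n * d * d) = c * (n * d * d).
  by rewrite -mulnDl subnK.
nia.
Qed.
End Shen.

Section Shen2.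
Variable T : finType.
Implicit Types (e : rel T) (S X : {set T}).

(** If [u] and [v] have common successors, let [w] be one that is sparse among
them: most of them are then not successors of [w], so the successors of [v] and
of [w] overlap little. *)
Lemma out_pair_large (E : rel T) S d p q u v :
  (forall u v, E u v -> (u \in S) && (v \in S)) ->
  (forall u, u \in S -> #|outs E u| = d) ->
  (forall X, X \proper S -> X != set0 ->
     exists2 x, x \in X & q * #|outs E x :&: X| <= p * #|X|) ->
  p <= q -> ~~ E u u -> E u v ->
  exists2 w, w = v \/ E u w /\ E v w &
    q * d + (q - p) * #|outs E u :&: outs E v| <= q * #|outs E v :|: outs E w|.
Proof.
move=> ES Ed IH pq nuu uv; have /andP[uS vS] := ES _ _ uv.
set Y := outs E u :&: outs E v.
have [Y0|Y0] := eqVneq Y set0.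
  by exists v; [left|rewrite setUid Ed // Y0 cards0 muln0 addn0].
have YS : Y \proper S.
  apply/properP; split; first by apply/subsetP=> x; rewrite !inE => /andP[/ES/andP[]].
  by exists u => //; rewrite !inE (negPf nuu).
have [w wY le] := IH Y YS Y0.
have [uw vw] : E u w /\ E v w by move: wY; rewrite !inE => /andP[].
have wS : w \in S by case/andP: (ES _ _ uw).
exists w; first by right.
have := cardsUI (outs E v) (outs E w); rewrite !Ed //.
have : #|outs E v :&: outs E w| + #|Y| <= #|outs E w :&: Y| + d.
  rewrite -(Ed v vS) -(cardsID Y (outs E v)) -(cardsID Y (outs E v :&: outs E w)).
  have -> : outs E v :&: Y = Y by rewrite /Y setIC -setIA setIid.
  have -> : outs E v :&: outs E w :&: Y = outs E w :&: Y.
    by rewrite /Y; apply/setP=> x; rewrite !inE; case: (E v x); rewrite ?andbF.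
  rewrite addnAC addnA leq_add2l; apply: subset_leq_card.
  by apply: setSD; apply: subsetIl.
nia.
Qed.

(** A smallest set [S] violating the bound can be thinned out to a digraph [E] of
constant outdegree [d] exceeding [(p / q) * #|S|], and the bound holds for the
proper subsets of [S].  For every arc, a set [X] that avoids the predecessors of
both ends limits the number of these predecessors; [arc_count] sums this up, with
weights [a], [b] and [c]. *)
Lemma sparse_of_arcs p q a b c (e : rel T) : p <= q -> 0 < q -> 0 < c -> b <= c ->
  2 * c * q <= (2 * a + 3 * c + b) * p ->
  girth_ge 4 e ->
  (forall (E : rel T) S d, subrel E e ->
    (forall u v, E u v -> (u \in S) && (v \in S)) ->
    (forall u, u \in S -> #|outs E u| = d) ->
    (forall X, X \proper S -> X != set0 ->
       exists2 x, x \in X & q * #|outs E x :&: X| <= p * #|X|) ->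
    forall u v, E u v -> exists X : {set T},
      [/\ X \subset S, (forall x, x \in X -> ~~ E x u /\ ~~ E x v) &
       a * d + b * #|outs E u :&: outs E v| <= c * #|X|]) ->
  sparse e p q.
Proof.
move=> pq q0 c0 bc cond ge HX S.
have [n] := ubnP #|S|; elim: n S => // n IHn S; rewrite ltnS => leS S0.
apply/exists_inP/contraT => /exists_inPn hS.
(* The least integer above (p / q) * #|S|. *)
pose d := (p * #|S|) %/ q + 1.
have qd : p * #|S| < q * d by rewrite /d addn1 (mulnC q) ltn_ceil.
have degS x : x \in S -> d <= #|outs e x :&: S|.
  move=> xS; have := hS x xS; rewrite -ltnNge /d addn1 ltn_divLR //.
  by rewrite (mulnC q).
pose F u := odflt set0 [pick B : {set T} | (B \subset outs e u :&: S) && (#|B| == d)].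
have FP u : u \in S -> F u \subset outs e u :&: S /\ #|F u| = d.
  move=> /degS/subset_of_card[B sB cB]; rewrite /F; case: pickP => [C /andP[sC /eqP]//|/(_ B)].
  by rewrite sB cB eqxx.
pose E : rel T := fun u v => (u \in S) && (v \in F u).
have nbE u : u \in S -> outs E u = F u.
  by move=> uS; apply/setP=> x; rewrite inE /E uS.
have Ee : subrel E e.
  move=> u v /andP[/FP[sF _] /(subsetP sF)]; by rewrite !inE => /andP[].
have ES u v : E u v -> (u \in S) && (v \in S).
  move=> /andP[uS vF]; rewrite uS; have [sF _] := FP u uS.
  by move: (subsetP sF _ vF); rewrite !inE => /andP[].
have Ed u : u \in S -> #|outs E u| = d by move=> uS; rewrite nbE //; case: (FP u uS).
have IH X : X \proper S -> X != set0 ->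
     exists2 x, x \in X & q * #|outs E x :&: X| <= p * #|X|.
  move=> XS X0; have [x xX le] := IHn X (leq_trans (proper_card XS) leS) X0.
  exists x => //; apply: leq_trans le; rewrite leq_mul2l; apply/orP; right.
  by apply/subset_leq_card/setSI; apply/subsetP=> y; rewrite !inE; apply: Ee.
clear nbE; clearbody E.
have d0 : 0 < d by rewrite /d addn1.
have gE : girth_ge 4 E := girth_ge_sub Ee ge.
have sumE : forall u, u \in S -> \sum_v E u v = d by move=> u /Ed; rewrite card_outs.
have asE := girth_ge_asym (girth_geW (isT : 3 <= 4) gE).
have main : (2 * a + 3 * c + b) * d <= 2 * c * #|S|.
  apply: (@arc_count T E S a b c d ES sumE asE d0 S0 bc) => u v uv.
  have [X [XS Xd Xc]] := HX E S d Ee ES Ed IH u v uv.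
  have c1 : \sum_z E u z * E v z = #|outs E u :&: outs E v|.
    rewrite card_outsI [RHS]big_mkcond /=; apply: eq_bigr => z _.
    by rewrite !inE; case: (E u z); case: (E v z).
  have c2 : \sum_w E w u * E w v = #|outs (rev_rel E) u :&: outs (rev_rel E) v|.
    rewrite card_outsI [RHS]big_mkcond /=; apply: eq_bigr => z _.
    by rewrite !inE /rev_rel; case: (E z u); case: (E z v).
  have c3 w : \sum_z E z w = #|outs (rev_rel E) w| by rewrite card_outs.
  rewrite c1 c2 !c3.
  set Iu := outs (rev_rel E) u; set Iv := outs (rev_rel E) v.
  have UI := cardsUI Iu Iv.
  have dis : #|X| + #|Iu :|: Iv| <= #|S|.
    have -> : #|X| + #|Iu :|: Iv| = #|X :|: (Iu :|: Iv)|.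
      suff X0 : X :&: (Iu :|: Iv) = set0 by rewrite [RHS]cardsU X0 cards0 subn0.
      apply/setP=> x; rewrite /Iu /Iv !inE /rev_rel.
      by case: (boolP (x \in X)) => //= /Xd[/negPf -> /negPf ->].
    apply: subset_leq_card; rewrite subUset XS; apply/subsetP=> x.
    by rewrite /Iu /Iv !inE /rev_rel => /orP[] /ES /andP[].
  have : c * #|X| + c * #|Iu :|: Iv| <= c * #|S| by rewrite -mulnDr leq_mul2l dis orbT.
  have : c * #|Iu :|: Iv| + c * #|Iu :&: Iv| = c * #|Iu| + c * #|Iv|.
    by rewrite -!mulnDr UI.
  move: Xc; lia.
have n0 : 0 < #|S| by rewrite card_gt0.
have h1 : (2 * a + 3 * c + b) * (p * #|S|) < (2 * a + 3 * c + b) * (q * d).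
  rewrite ltn_pmul2l //; by move: c0; clear; lia.
have h2 : q * ((2 * a + 3 * c + b) * d) <= q * (2 * c * #|S|) by rewrite leq_mul2l main orbT.
have h3 : 2 * c * q * #|S| <= (2 * a + 3 * c + b) * p * #|S| by rewrite leq_mul2r cond orbT.
move: h1 h2 h3; set K := 2 * a + 3 * c + b; nia.
Qed.

Lemma no_triangle g (E : rel T) x y z : girth_ge g E -> 3 < g -> E x y -> E y z -> ~~ E z x.
Proof.
move=> h g3 xy yz; apply/negP=> zx; have /negP := h 3 x isT g3; apply.
rewrite walkS; apply/existsP; exists y; rewrite xy walkS; apply/existsP; exists z.
by rewrite yz walk1.
Qed.

(** A successor of [v] or of [w] that precedes [u] or [v] would close a triangle or
a digon. *)
Lemma sparse_girth4 e : girth_ge 4 e -> sparse e 5 14.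
Proof.
move=> ge; apply: (@sparse_of_arcs 5 14 14 9 14) => //.
move=> E S d Ee ES Ed IH u v uv.
have gE : girth_ge 4 E := girth_ge_sub Ee ge.
have as2 := girth_ge_asym (girth_geW (isT : 3 <= 4) gE).
have nuu : ~~ E u u by have := as2 u u; rewrite andbb.
have [w hw le] := out_pair_large ES Ed IH isT nuu uv.
exists (outs E v :|: outs E w); split => //.
  by apply/subsetP=> x; rewrite !inE => /orP[] /ES /andP[].
move=> x; rewrite !inE => /orP[vx|wx].
  by split; [apply: no_triangle gE isT uv vx|have := as2 v x; rewrite vx].
case: hw => [wv|[uw vw]].
  by subst w; split; [apply: no_triangle gE isT uv wx|have := as2 v x; rewrite wx].
by split; [apply: no_triangle gE isT uw wx|apply: no_triangle gE isT vw wx].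
Qed.

(** Girth five also keeps the successors of the vertices of [X1] from preceding [u]
or [v], and a vertex that is sparse in [X1] has many successors outside [X1]. *)
Lemma sparse_girth5 e : girth_ge 5 e -> sparse e 7 24.
Proof.
(* Two applications of the bound 7/24 leave weights over 24 ^ 2. *)
move=> ge; apply: (@sparse_of_arcs 7 24 (24 * 41) (17 * 17) (24 * 24)); try lia.
  exact: girth_geW ge.
move=> E S d Ee ES Ed IH u v uv; have /andP[uS vS] := ES _ _ uv.
have gE : girth_ge 5 E := girth_ge_sub Ee ge.
have as2 := girth_ge_asym (girth_geW (isT : 3 <= 5) gE).
have nuu : ~~ E u u by have := as2 u u; rewrite andbb.
have [w hw le] := out_pair_large ES Ed IH isT nuu uv.
set X1 := outs E v :|: outs E w in le.
have X1S : X1 \subset S.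
  by apply/subsetP=> x; rewrite !inE => /orP[] /ES /andP[].
have key x : x \in X1 -> [/\ ~~ E x u, ~~ E x v &
   forall y, E x y -> ~~ E y u /\ ~~ E y v].
  move=> xX.
  have W k y : walk E k y x -> forall j, 0 < k + j -> k + j < 5 -> ~~ walk E j x y.
    move=> wk j j0 j5; apply/negP=> wj; have /negP := gE (k + j) y j0 j5; apply.
    exact: walkD wk wj.
  have W2 y : E x y -> forall z, E y z -> walk E 2 x z.
    by move=> xy z yz; rewrite walkS; apply/existsP; exists y; rewrite xy walk1.
  have hv : exists2 k, (0 < k) && (k < 3) & walk E k v x.
    move: xX; rewrite !inE => /orP[vx|wx]; first by exists 1; rewrite ?walk1.
    case: hw => [wv|[uw vw]]; first by subst w; exists 1; rewrite ?walk1.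
    by exists 2; rewrite // walkS; apply/existsP; exists w; rewrite vw walk1.
  have hu : walk E 2 u x.
    rewrite walkS; apply/existsP; move: xX; rewrite !inE => /orP[vx|wx].
      by exists v; rewrite uv walk1.
    case: hw => [wv|[uw vw]]; first by subst w; exists v; rewrite uv walk1.
    by exists w; rewrite uw walk1.
  case: hv => k /andP[k0 k3] wk; have k5 : k + 2 < 3 + 2 by rewrite ltn_add2r.
  split.
  - by rewrite -walk1; apply: (W 2).
  - by rewrite -walk1; apply: (W k) => //; rewrite addn1 // ltnW // -addn2.
  move=> y xy; split; apply/negP=> h.
    by have /negP := W 2 u hu 2 isT isT; apply; apply: W2 xy _ h.
  have /negP := W k v wk 2 (ltn_addr 2 k0) k5; apply; apply: W2 xy _ h.
have X1u : X1 \proper S.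
  apply/properP; split => //; exists v => //.
  have nvv : ~~ E v v by have := as2 v v; rewrite andbb.
  rewrite !inE (negPf nvv) /=; case: hw => [->//|[_ vw]].
  by have := as2 v w; rewrite vw.
have X10 : X1 != set0.
  have : 0 < #|outs E u| by rewrite card_gt0; apply/set0Pn; exists v; rewrite inE.
  rewrite Ed // -card_gt0; move: le; set a := #|X1|; set b := #|_ :&: _|; lia.
have [z zX lez] := IH X1 X1u X10.
exists (X1 :|: outs E z); split.
- by rewrite subUset X1S; apply/subsetP=> x; rewrite inE => /ES /andP[].
- move=> x; rewrite in_setU => /orP[/key[]|] //; rewrite inE => zx.
  by have [_ _ h] := key z zX; apply: h.
have zS : z \in S by apply: (subsetP X1S).
have := cardsUI X1 (outs E z); rewrite setIC Ed //.
move: lez le; move: #|X1 :|: outs E z| #|outs E z :&: X1| #|X1| #|_ :&: _|.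
by clear; lia.
Qed.
End Shen2.

Section Bounds.
Variable T : finType.
Implicit Types (e : rel T) (S : {set T}).

(** Each contraction raises the girth by two and [q / p] by one. *)
Lemma sparse_odd_girth h e : girth_ge (2 * h + 3) e -> sparse e 1 (h + 2).
Proof.
elim: h e => [|h IH] e; first exact: sparse_girth3.
have -> : 2 * h.+1 + 3 = (2 * h + 3).+2 by lia.
have -> : h.+1 + 2 = 1 + (h + 2) by lia.
by apply: sparse_contract => //; lia.
Qed.

Lemma sparse_even_girth h e : girth_ge (2 * h + 4) e -> sparse e 5 (5 * h + 14).
Proof.
elim: h e => [|h IH] e; first exact: sparse_girth4.
have -> : 2 * h.+1 + 4 = (2 * h + 4).+2 by lia.
have -> : 5 * h.+1 + 14 = 5 + (5 * h + 14) by lia.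
by apply: sparse_contract => //; lia.
Qed.

(** Strong connectivity, with a period divisible by [k]. *)
Definition periodic k e :=
  (forall u v, exists j, walk e j u v) /\ (forall v j, walk e j v v -> k %| j).

(** The length of a walk to a fixed vertex is determined modulo [k]. *)
Lemma homomorphic_periodic k e : 0 < k -> periodic k e -> homomorphic e (dicycle k).
Proof.
move=> k0 [con div].
case: (pickP (@predT T)) => [v0 _|T0]; last first.
  by exists (fun=> Ordinal k0) => u v; have := T0 u.
have [f fP] := fin_all_exists (con v0).
exists (fun u => Ordinal (ltn_pmod (f u) k0)) => u w uw.
apply/eqP/val_inj => /=; have [c wc] := con w v0.
have d1 : k %| f u + (1 + c).
  apply: (div v0); apply: walkD (fP u) _; apply: walkD _ wc; by rewrite walk1.
have d2 : k %| f w + c by apply: (div v0); apply: walkD (fP w) wc.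
rewrite -addn1 modnDml; apply/eqP; rewrite -(eqn_modDr c).
by rewrite (eqP d2) -addnA (eqP d1).
Qed.

(** A closed walk of length [j], run through [m] times, is a closed walk of length
[j] in the power. *)
Lemma periodic_power k m e : periodic k (walk e m) -> periodic k e.
Proof.
move=> [con div]; split=> [u v|v j w].
  by have [j w] := con u v; exists (j * m); rewrite -walkM.
by apply: (div v); rewrite walkM mulnC; apply: walk_mul.
Qed.

Definition outdeg_ge d e := forall x, d <= #|outs e x|.

Lemma walk_total d e i x : 0 < d -> outdeg_ge d e -> exists y, walk e i x y.
Proof.
move=> d0 h; elim: i x => [|i IH] x; first by exists x => /=.
have /card_gt0P[y] : 0 < #|outs e x| by apply: leq_trans (h x).
rewrite inE => xy; have [z yz] := IH y; exists z.
by rewrite walkS; apply/existsP; exists y; rewrite xy.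
Qed.

Lemma outdeg_ge_power d e m : 0 < d -> 0 < m -> outdeg_ge d e -> outdeg_ge d (walk e m).
Proof.
case: m => // m d0 _ h x; have [y xy] := walk_total m x d0 h.
apply: leq_trans (h y) _; apply: subset_leq_card; apply/subsetP=> z; rewrite !inE => yz.
by rewrite -addn1; apply: walkD xy _; rewrite walk1.
Qed.

Lemma indeg_ge_power d e m : 0 < d -> 0 < m -> outdeg_ge d (rev_rel e) ->
  outdeg_ge d (rev_rel (walk e m)).
Proof.
move=> d0 m0 /(outdeg_ge_power d0 m0) h x; apply: leq_trans (h x) _.
by apply: subset_leq_card; apply/subsetP=> z; rewrite !inE walk_rev.
Qed.

Definition no_closed e l := forall x, ~~ walk e l x x.

Lemma no_closed_power e m l : no_closed e (l * m) -> no_closed (walk e m) l.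
Proof. by move=> h x; rewrite walkM. Qed.

Lemma no_closed_dvd e l j x : no_closed e l -> j %| l -> ~~ walk e j x x.
Proof.
move=> h /dvdnP[q lq]; apply/negP=> w; have /negP := h x; apply.
by rewrite lq; apply: walk_mul.
Qed.

Lemma no_closed_comb e l i j a b x : no_closed e l -> a * i + b * j = l ->
  walk e i x x -> ~~ walk e j x x.
Proof.
move=> h lq wi; apply/negP=> wj; have /negP := h x; apply; rewrite -lq.
by apply: walkD; apply: walk_mul.
Qed.

Lemma no_closed_rev e l : no_closed e l -> no_closed (rev_rel e) l.
Proof. by move=> h x; rewrite walk_rev. Qed.

(** Closed walks as periodic sequences, so that positions can be shifted without
reducing them modulo [g]. *)
Definition closed_seq g e (c : nat -> T) :=
  (forall i, e (c i) (c i.+1)) /\ (forall i, c (i + g) = c i).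

Lemma closed_seqP g e x : 0 < g -> walk e g x x -> exists2 c, closed_seq g e c & c 0 = x.
Proof.
move=> g0 /walk_path[p [hp sp lp]].
pose c i := nth x (x :: p) (i %% g).
have cg i : c (i + g) = c i by rewrite /c modnDr.
have e1 i : i < g -> e (c i) (c i.+1).
  move=> ig; rewrite /c modn_small //.
  have -> : nth x (x :: p) (i.+1 %% g) = nth x p i.
    case: (ltnP i.+1 g) => h; first by rewrite modn_small.
    have gi : g = i.+1 by lia.
    by rewrite gi modnn /= -[LHS]lp (last_nth x) sp gi.
  by apply: (pathP x hp); rewrite sp.
exists c; last by rewrite /c mod0n.
have ck a q : c (a + q * g) = c a.
  by elim: q => [|q IH]; rewrite ?addn0 // mulSn addnCA addnC cg.
split=> // i; rewrite (divn_eq i g) addnC -addSn !ck.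
by apply: e1; rewrite ltn_mod.
Qed.

(** The factor [g.-1] is -1 modulo [g]. *)
Lemma closed_seq_rev g e c : 0 < g -> closed_seq g e c -> closed_seq g (rev_rel e) (fun i => c (i * g.-1)).
Proof.
move=> g0 [ec pc]; split=> i.
  rewrite /rev_rel -[c (i * _)]pc.
  by have -> : i * g.-1 + g = (i.+1 * g.-1).+1 by lia.
have ck a q : c (a + q * g) = c a.
  by elim: q => [|q IH]; rewrite ?addn0 // mulSn addnCA addnC pc.
by rewrite mulnDl [g * _]mulnC ck.
Qed.

Lemma closed_seq_mod g e c i : closed_seq g e c -> c (i %% g) = c i.
Proof.
move=> [_ pc]; rewrite [in RHS](divn_eq i g) addnC.
by elim: (i %/ g) => [|q IH]; rewrite ?addn0 // mulSn addnCA addnC pc.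
Qed.

Lemma closed_seq_walk g e c i j : closed_seq g e c -> walk e j (c i) (c (i + j)).
Proof.
move=> [ec _]; elim: j i => [|j IH] i; first by rewrite addn0 /=.
rewrite walkS; apply/existsP; exists (c i.+1); rewrite ec.
by rewrite addnS -addSn IH.
Qed.

(** The walk from [c r] to [c s] is completed along the closed walk itself. *)
Lemma closed_seq_close g e c r s j : 0 < g -> closed_seq g e c -> r < g -> s < g ->
  walk e j (c r) (c s) -> walk e (j + (r + g - s) %% g) (c r) (c r).
Proof.
move=> g0 C rg sg w; apply: walkD w _.
have -> : c r = c (s + (r + g - s) %% g); last exact: closed_seq_walk C.
rewrite -(closed_seq_mod (s + _) C) modnDmr subnKC; last by lia.
by rewrite modnDr modn_small.
Qed.

End Bounds.

(** * Periodicity from short connecting walks *)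

Section Soft.
Variable T : finType.
Implicit Types (e : rel T) (S : {set T}).

Lemma periodic_label g e (f : T -> nat) :
  (forall u v, exists j, walk e j u v) ->
  (forall u w, e u w -> f w = (f u).+1 %[mod g]) -> periodic g e.
Proof.
move=> con hf; split=> // v j.
have : forall j u w, walk e j u w -> f w = f u + j %[mod g].
  elim=> [|i IH] u w; first by move=> /= /eqP ->; rewrite addn0.
  rewrite walkS => /existsP[z /andP[/hf uz /IH ->]].
  by rewrite -modnDml uz modnDml addSnnS.
move=> /[apply] /eqP h; have : 0 == j %[mod g] by rewrite -(eqn_modDl (f v)) addn0.
by rewrite mod0n eq_sym.
Qed.

(** Each of the [g] residue classes contains all successors of some vertex. *)
Lemma periodic_card g e d (v0 : T) : 0 < d -> 0 < g -> periodic g e -> outdeg_ge d e ->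
  g * d <= #|T|.
Proof.
move=> d0 g0 Pe hd; have [f fP] := homomorphic_periodic g0 Pe.
have fw j u w : walk e j u w -> val (f w) = (f u + j) %% g.
  elim: j u => [|j IH] u; first by move=> /= /eqP ->; rewrite addn0 modn_small.
  rewrite walkS => /existsP[z /andP[/fP/eqP uz /IH ->]].
  by rewrite uz /= modnDml addSnnS.
have cl (i : 'I_g) : d <= #|[set x | f x == i]|.
  have [y wy] := walk_total (i + (g - f v0) + g.-1) v0 d0 hd.
  apply: leq_trans (hd y) _; apply: subset_leq_card; apply/subsetP=> z.
  rewrite !inE => /fP/eqP ->; apply/eqP/val_inj => /=.
  rewrite (fw _ _ _ wy) -addn1 modnDml.
  have -> : f v0 + (i + (g - f v0) + g.-1) + 1 = i + g + g by have := ltn_ord (f v0); lia.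
  by rewrite !modnDr modn_small.
have -> : g * d = \sum_(i < g) d by rewrite sum_nat_const card_ord.
have -> : #|T| = \sum_(i < g) #|[set x | f x == i]|.
  rewrite -sum1_card (partition_big f predT) //=.
  by apply: eq_bigr => i _; rewrite sum1dep_card.
by apply: leq_sum.
Qed.

Lemma linear_congruence s g l : 0 < g -> gcdn s g %| l -> exists2 b, b < g & b * s = l %[mod g].
Proof.
move=> g0 /dvdnP[q ->]; have [a ag] := Bezoutl s g0; rewrite gcdnC => dv.
exists ((q * (g - a)) %% g); first by rewrite ltn_mod.
rewrite modnMml; apply/eqP; rewrite -(eqn_modDr (q * a * s)).
have -> : q * (g - a) * s + q * a * s = q * s * g by rewrite -mulnDl -mulnDr subnK 1?ltnW //; lia.
have -> : q * gcdn s g + q * a * s = q * (gcdn s g + a * s) by nia.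
rewrite modnMl; apply/eqP/esym/eqP.
by have := dvdn_mull q dv; rewrite /dvdn.
Qed.

(** Let [s] be the length of a short closed walk through [v], not divisible by [g].
Then [gcdn s g] is a proper divisor of [g], hence smaller than [k] and a divisor
of [l], so [b * s + a * g = l] has a solution with [b < g]; here [a] is
nonnegative because [l] is large.  Running through the two closed walks [b] and [a]
times gives a closed walk of length [l], a contradiction.  An arc together with
short walks from [v] to its tail and from its head to [v] makes a closed walk of
length at most [2 * D + 1]; so the lengths of these walks label the vertices
modulo [g]. *)
Lemma periodic_of_short_walks l k g D e v : 0 < g -> no_closed e l -> walk e g v v ->
  (forall x y, exists2 j, j <= D & walk e j x y) ->
  (forall j, 0 < j -> j < k -> j %| l) -> g < 2 * k -> g.-1 * (2 * D + 1) <= l ->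
  periodic g e.
Proof.
move=> g0 nl wg con dv gk lD.
have ngl : ~~ (g %| l).
  by apply/negP=> gl; have /negP := no_closed_dvd v nl gl; apply.
have key s : s <= 2 * D + 1 -> walk e s v v -> g %| s.
  move=> sD ws; apply/contraT => ngs.
  have dl : gcdn s g %| l.
    apply: dv; first by rewrite gcdn_gt0 g0 orbT.
    have /dvdnP[q gq] := dvdn_gcdr s g.
    case: q gq => [|[|q]] gq; [lia| |nia].
    by move: ngs; rewrite gq mul1n dvdn_gcdl.
  have [b bg bs] := linear_congruence g0 dl.
  have ble : b * s <= l by apply: leq_trans lD; apply: leq_mul => //; lia.
  have /dvdnP[a la] : g %| l - b * s by rewrite -eqn_mod_dvd // bs.
  have lq : b * s + a * g = l by rewrite -la subnKC.
  by have := no_closed_comb nl lq ws; rewrite wg.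
have [f fP fw] := fin_all_exists2 (con v).
have [h hP hw] := fin_all_exists2 (con^~ v).
apply: (@periodic_label g e f).
  by move=> x y; have [j _ w] := con x y; exists j.
move=> u w uw; have /eqP d1 : g %| f u + (1 + h w).
  apply: key; first by have := fP u; have := hP w; lia.
  by apply: walkD (fw u) _; apply: walkD (hw w); rewrite walk1.
have /eqP d2 : g %| f w + h w.
  apply: key; first by have := fP w; have := hP w; lia.
  exact: walkD (fw w) (hw w).
by apply/eqP; rewrite -(eqn_modDr (h w)) d2 -addn1 -addnA d1.
Qed.

(** Iterating [r' >= (1 - p / q) * r + d] sums a geometric series: balls of radius
[i + 1] have at least [(q / p) * (1 - (1 - p / q) ^ (i + 1)) * d] vertices. *)
Lemma reach_geometric p q e d i x : 0 < d -> 0 < q -> p <= q -> sparse e p q -> outdeg_ge d e ->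
  q ^ i.+1 * d <= p * q ^ i * #|outs (reach e i.+1) x| + (q - p) ^ i.+1 * d.
Proof.
move=> d0 q0 pq B hd.
have h1 y : d <= #|outs (reach e 1) y|.
  by apply: leq_trans (hd y) _; apply/subset_leq_card/subsetP=> z; rewrite !inE reach1.
have B1 : sparse (reach e 1) p q.
  move=> S S0; have [y yS le] := B S S0; exists y => //; apply: leq_trans le.
  rewrite leq_mul2l; apply/orP; right; apply: subset_leq_card.
  by apply: setSI; apply/subsetP=> z; rewrite !inE reach1.
elim: i => [|i IH].
  rewrite !expn1 expn0 muln1 -[X in X * d <= _](subnKC pq) mulnDl leq_add2r.
  by rewrite leq_mul2l h1 orbT.
have S0 : outs (reach e i.+1) x != set0.
  rewrite -card_gt0; apply: leq_trans d0 (leq_trans (h1 x) _).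
  by apply/subset_leq_card/subsetP=> z; rewrite !inE; apply: reachW.
have := out_closure_grow pq B1 S0 (fun y _ => h1 y).
have := subset_leq_card (out_closure_reach e i.+1 1 x); rewrite addn1.
move: IH; rewrite !(expnS _ i.+1).
set a := #|_|; set Q := q ^ i.+1; set P := (q - p) ^ i.+1.
set c := #|_|; set b := #|_| => IH cb gr.
have {cb}gr : (q - p) * a + q * d <= q * b.
  by apply: leq_trans gr _; rewrite leq_mul2l cb orbT.
have l1 : (q - p) * (Q * d) <= (q - p) * (p * q ^ i * a + P * d).
  by rewrite leq_mul2l IH orbT.
have l2 : p * q ^ i * ((q - p) * a + q * d) <= p * q ^ i * (q * b).
  by rewrite leq_mul2l gr orbT.
have eQ : Q = q * q ^ i by rewrite /Q expnS.
have e1 : q * Q * d = (q - p) * (Q * d) + p * q ^ i * (q * d).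
  by rewrite -[X in X * Q](subnK pq) eQ; lia.
rewrite e1 eQ in l1 l2 *; lia.
Qed.

Lemma sparseW e p q p' q' : 0 < q -> p * q' <= p' * q -> sparse e p q -> sparse e p' q'.
Proof.
move=> q0 le B S S0; have [x xS lx] := B S S0; exists x => //.
rewrite -(leq_pmul2l q0).
have l1 : q' * (q * #|outs e x :&: S|) <= q' * (p * #|S|) by rewrite leq_mul2l lx orbT.
have l2 : p * q' * #|S| <= p' * q * #|S| by rewrite leq_mul2r le orbT.
move: l1 l2; nia.
Qed.

Lemma sparse_girth k e : 2 < k -> girth_ge k e -> sparse e 2 k.+1.
Proof.
move=> k2 gk; case: (boolP (odd k)) => odd_k.
  have [h hk] : exists h, k = 2 * h + 3 by exists ((k - 3) %/ 2); lia.
  rewrite hk in gk *; apply: sparseW (sparse_odd_girth gk); lia.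
have [h hk] : exists h, k = 2 * h + 4 by exists ((k - 4) %/ 2); lia.
rewrite hk in gk *; apply: sparseW (sparse_even_girth gk); lia.
Qed.

End Soft.

(** * Girth and diameter *)

Section Large.
Variable T : finType.
Implicit Types (e : rel T) (S : {set T}).

Lemma sparse_outdeg e d p q : T -> sparse e p q -> outdeg_ge d e -> q * d <= p * #|T|.
Proof.
move=> x0 B hd; have [|x _ le] := B [set: T].
  by apply/set0Pn; exists x0; rewrite inE.
rewrite setIT cardsT in le; apply: leq_trans le.
by rewrite leq_mul2l hd orbT.
Qed.

Lemma girth_attained e g0 : ~ girth_ge g0 e ->
  exists g, exists2 v, girth_ge g e & 0 < g < g0 /\ walk e g v v.
Proof.
elim: g0 => [|g0 IH] h; first by case: h => j x _; rewrite ltn0.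
case: (boolP [exists v, (0 < g0) && walk e g0 v v]) => [/existsP[v /andP[g00 w]]|nw].
  case: (boolP [forall v, [forall j : 'I_g0, (0 < j) ==> ~~ walk e j v v]]).
    move=> a; exists g0, v => //; last by rewrite g00 ltnSn.
    move=> j x j0 jg; have /forallP/(_ x)/forallP/(_ (Ordinal jg))/implyP := a.
    exact.
  case/forallPn=> x /forallPn[j]; rewrite negb_imply negbK => /andP[j0 wj].
  have [|g [u gg [/andP[h0 h1] wg]]] := IH.
    by move=> hg; have := hg j x j0 (ltn_ord j); rewrite wj.
  by exists g, u => //; split=> //; rewrite h0 (ltn_trans h1).
have [|g [u gg [/andP[h0 h1] wg]]] := IH.
  move=> hg; apply: h => j x j0; rewrite ltnS leq_eqVlt => /orP[/eqP jg|]; last exact: hg.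
  by move: nw => /existsPn/(_ x); rewrite -jg j0.
by exists g, u => //; split=> //; rewrite h0 (ltn_trans h1).
Qed.

(** The assumption on the minimum semidegree [d], cleared of denominators. *)
Definition degree_bound k d := #|T| * (30 * k - 1) <= 30 * k * k * d.

(** The girth [g] is at least [k], as all smaller lengths divide [l], and less than
[2 * k] by [sparse_even_girth] and the degree bound.  A period [g] requires
[g * d] vertices, which leaves only [g = k]. *)
Lemma periodic_of_diameter l k d e (x0 : T) : 2 < k -> 0 < d -> degree_bound k d ->
  outdeg_ge d e -> no_closed e l ->
  (forall j, 0 < j -> j < k -> j %| l) ->
  (forall g, girth_ge g e -> k <= g -> g < 2 * k -> exists D, g.-1 * (2 * D + 1) <= l /\
     forall x y, exists2 j, j <= D & walk e j x y) ->
  periodic k e.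
Proof.
move=> k2 d0 dn hd nl dv hD; have n0 : 0 < #|T| by apply/card_gt0P; exists x0.
have gk : girth_ge k e by move=> j x j0 jk; apply: (no_closed_dvd _ nl); apply: dv.
have [|g [v gg [/andP[g0 g2k] w]]] := @girth_attained e (2 * k).
  (* Girth 2k would give a vertex of outdegree at most 5n / (5k + 4). *)
  move=> g2; have : girth_ge (2 * (k - 2) + 4) e by apply: girth_geW g2; lia.
  move/sparse_even_girth/(sparse_outdeg x0)/(_ hd) => le.
  rewrite /degree_bound in dn; set n := #|T| in le dn n0.
  have [k' kk] : exists k', k = k' + 2 by exists (k - 2); lia.
  rewrite kk in le dn; have e1 : (5 * (k' + 2 - 2) + 14) = 5 * k' + 14 by lia.
  rewrite e1 in le; have e2 : 30 * (k' + 2) - 1 = 30 * k' + 59 by lia.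
  rewrite e2 in dn.
  have l1 : (5 * k' + 14) * (n * (30 * k' + 59)) <= 30 * (k' + 2) * (k' + 2) * (5 * n).
    apply: leq_trans (_ : (5 * k' + 14) * (30 * (k' + 2) * (k' + 2) * d) <= _).
      by rewrite leq_mul2l dn orbT.
    rewrite mulnCA leq_mul2l le; lia.
  nia.
have kg : k <= g.
  by rewrite leqNgt; apply/negP=> gk'; have := gk g v g0 gk'; rewrite w.
have [D [Dl con]] := hD g gg kg g2k.
have Pg := periodic_of_short_walks g0 nl w con dv g2k Dl.
have sz := periodic_card x0 d0 g0 Pg hd.
suff -> : k = g by [].
apply/eqP; rewrite eqn_leq kg /= leqNgt; apply/negP=> kg'.
have : k.+1 * d <= #|T| by apply: leq_trans sz; rewrite leq_mul2r kg' orbT.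
rewrite /degree_bound in dn; move: dn; set n := #|T|; move=> dn le.
have l1 : k.+1 * d * (30 * k - 1) <= 30 * k * k * d.
  by apply: leq_trans dn; rewrite leq_mul2r le orbT.
have e2 : 30 * k = (30 * k - 1).+1 by lia.
have l2 : k.+1 * (30 * k - 1) <= 30 * k * k.
  by rewrite -(leq_pmul2r d0); apply: leq_trans l1; lia.
nia.
Qed.

Lemma diameter_of_half e m : 
  (forall x, #|T| < 2 * #|outs (reach e m) x|) ->
  (forall x, #|T| < 2 * #|outs (reach (rev_rel e) m) x|) ->
  forall x y, exists2 j, j <= 2 * m & walk e j x y.
Proof.
move=> h h' x y; have [] := @reach_meet T e m m x y.
  by have := h x; have := h' y; lia.
move=> a [b [z [ha hb wa wb]]]; exists (a + b); first by lia.
exact: walkD wa wb.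
Qed.

Lemma half_reach_geometric p q k d e i : 0 < d -> 0 < q -> p <= q ->
  sparse e p q -> outdeg_ge d e -> degree_bound k d -> 0 < k ->
  2 * (30 * k - 1) * (q - p) ^ i.+1 + 30 * k * k * p * q ^ i <
    2 * (30 * k - 1) * q ^ i.+1 ->
  forall x, #|T| < 2 * #|outs (reach e i.+1) x|.
Proof.
move=> d0 q0 pq B hd dn k0 lt x; rewrite ltnNge; apply/negP=> le.
have l1 := reach_geometric i x d0 q0 pq B hd.
move: l1 le lt dn; rewrite /degree_bound; set a := #|_|; set n := #|T|.
set Q := q ^ i.+1; set P := (q - p) ^ i.+1; set Q' := q ^ i; set h := 30 * k - 1.
move=> l1 le lt dn.
have l2 : 2 * h * (Q * d) <= 2 * h * (p * Q' * a + P * d) by rewrite leq_mul2l l1 orbT.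
have l3 : h * p * Q' * (2 * a) <= h * p * Q' * n by rewrite leq_mul2l le orbT.
have l4 : p * Q' * (n * h) <= p * Q' * (30 * k * k * d) by rewrite leq_mul2l dn orbT.
have l5 : (2 * h * P + 30 * k * k * p * Q') * d < 2 * h * Q * d by rewrite ltn_pmul2r.
move: l2 l3 l4 l5; clear -d; lia.
Qed.

(** As long as a ball contains at most half of the [n] vertices, the bound
[2 / (k + 1)] costs at most [n / (k + 1)] of the [d] vertices that a step could
gain.  What remains is of order [d / (k + 1)], and [k * k] steps are plenty. *)
Lemma half_reach_square k d e : 12 < k -> 0 < d ->
  degree_bound k d -> girth_ge k e -> outdeg_ge d e ->
  forall x, #|T| < 2 * #|outs (reach e (k * k)) x|.
Proof.
move=> k12 d0 dn gk hd.
have B := sparse_girth (ltn_trans (isT : 2 < 12) k12) gk.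
have B1 : sparse (reach e 1) 2 k.+1.
  move=> S S0; have [y yS le] := B S S0; exists y => //; apply: leq_trans le.
  rewrite leq_mul2l; apply/orP; right; apply: subset_leq_card.
  by apply: setSI; apply/subsetP=> z; rewrite !inE reach1.
have h1 y : d <= #|outs (reach e 1) y|.
  by apply: leq_trans (hd y) _; apply/subset_leq_card/subsetP=> z; rewrite !inE reach1.
have step i x : #|T| < 2 * #|outs (reach e i.+1) x| \/
    9 * i.+1 * d <= 10 * k.+1 * #|outs (reach e i.+1) x|.
  elim: i => [|i IH].
    by right; have := h1 x; nia.
  have mono : #|outs (reach e i.+1) x| <= #|outs (reach e i.+2) x|.
    by apply/subset_leq_card/subsetP=> z; rewrite !inE; apply: reachW.
  case: (ltnP #|T| (2 * #|outs (reach e i.+1) x|)) => [lt|ge]; first by left; lia.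
  case: IH => [|IH]; first by lia.
  right; have S0 : outs (reach e i.+1) x != set0.
    rewrite -card_gt0; apply: leq_trans d0 (leq_trans (h1 x) _).
    by apply/subset_leq_card/subsetP=> z; rewrite !inE; apply: reachW.
  have k2 : 2 <= k.+1 by lia.
  have := out_closure_grow k2 B1 S0 (fun y _ => h1 y).
  have := subset_leq_card (out_closure_reach e i.+1 1 x); rewrite addn1.
  move: ge IH dn; rewrite /degree_bound; clear -k12.
  set n := #|T|; set a := #|_|; set c := #|_|; set b := #|_| => ge IH dn cb gr.
  have l1 : k.+1 * c <= k.+1 * b by rewrite leq_mul2l cb orbT.
  have e1 : (k.+1 - 2) * a + 2 * a = k.+1 * a by rewrite -mulnDl subnK //; lia.
  have l2 : k.+1 * a + k.+1 * d <= k.+1 * b + n by lia.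
  (* Each step gains at least 9d / (10 (k + 1)) vertices. *)
  have l3 : 10 * n + 9 * d <= 10 * k.+1 * d.
    have e2 : 0 < 30 * k - 1 by lia.
    rewrite -(leq_pmul2r e2).
    have e3 : exists k', k = k' + 13 by exists (k - 13); lia.
    case: e3 => k' kk; move: dn; rewrite kk.
    have -> : 30 * (k' + 13) - 1 = 30 * k' + 389 by lia.
    nia.
  nia.
move=> x; have [m km] : exists m, k * k = m.+1 by exists (k * k).-1; nia.
case: (step m x); rewrite -km // => le.
move: le dn; rewrite /degree_bound; set a := #|_|; set n := #|T| => le dn.
rewrite ltnNge; apply/negP=> an.
have l1 : 5 * k.+1 * (n * (30 * k - 1)) <= 5 * k.+1 * (30 * k * k * d).
  by rewrite leq_mul2l dn orbT.
have l2 : 9 * (k * k) * d * (30 * k - 1) <= 5 * k.+1 * (n * (30 * k - 1)).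
  rewrite [X in _ <= X]mulnA leq_mul2r; apply/orP; right; nia.
have l3 : 9 * (30 * k - 1) * (k * k * d) <= 150 * k.+1 * (k * k * d) by lia.
have kd : 0 < k * k * d by rewrite !muln_gt0 d0; lia.
by move: l3; rewrite leq_pmul2r //; lia.
Qed.

End Large.

(** * Common multiples of an initial segment *)

Section Arith.
Variables (l k : nat).
Hypotheses (l0 : 0 < l) (dv : forall j, 0 < j -> j < k -> j %| l).

Lemma mul_window_dvd m j : 0 < j -> j < k -> coprime m j -> m %| l -> m * j %| l.
Proof. by move=> j0 jk mj ml; rewrite Gauss_dvd // ml dv. Qed.

Lemma window_ge8 : 7 < k -> 5 * 4 * 3 * 7 <= l.
Proof.
move=> k7; apply: dvdn_leq => //.
by do ?[apply: mul_window_dvd; [done|lia|by rewrite ?coprimeMl|]]; apply: dv; lia.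
Qed.

Lemma window_ge9 : 8 < k -> 5 * 8 * 3 * 7 <= l.
Proof.
move=> k7; apply: dvdn_leq => //.
by do ?[apply: mul_window_dvd; [done|lia|by rewrite ?coprimeMl|]]; apply: dv; lia.
Qed.

Lemma window_ge10 : 9 < k -> 5 * 8 * 9 * 7 <= l.
Proof.
move=> k7; apply: dvdn_leq => //.
by do ?[apply: mul_window_dvd; [done|lia|by rewrite ?coprimeMl|]]; apply: dv; lia.
Qed.

Lemma window_ge13 : 12 < k -> 5 * 8 * 9 * 7 * 11 <= l.
Proof.
move=> k7; apply: dvdn_leq => //.
by do ?[apply: mul_window_dvd; [done|lia|by rewrite ?coprimeMl|]]; apply: dv; lia.
Qed.

Lemma window_ge16 : 15 < k -> 5 * 8 * 9 * 7 * 11 * 13 <= l.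
Proof.
move=> k7; apply: dvdn_leq => //.
by do ?[apply: mul_window_dvd; [done|lia|by rewrite ?coprimeMl|]]; apply: dv; lia.
Qed.

Lemma window_ge20 : 19 < k -> 5 * 8 * 9 * 7 * 11 * 13 * 17 * 19 <= l.
Proof.
move=> k7; apply: dvdn_leq => //.
by do ?[apply: mul_window_dvd; [done|lia|by rewrite ?coprimeMl|]]; apply: dv; lia.
Qed.

(** With [p] and [q] the two products,
[16 * p + 2 * q + 4 * a * q = 12 + 2 * p + 4 * a * p]. *)
Lemma gcd_window a : 2 < a ->
  gcdn (a * (a - 1)) ((a - 2) * (a - 3)) %| 12.
Proof.
move=> a2; set p := a * (a - 1); set q := (a - 2) * (a - 3).
have e : 16 * p + 2 * q + 4 * a * q = 12 + 2 * p + 4 * a * p.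
  have [b ab] : exists b, a = b + 3 by exists (a - 3); lia.
  rewrite /p /q ab.
  have -> : b + 3 - 1 = b + 2 by lia. have -> : b + 3 - 2 = b + 1 by lia.
  have -> : b + 3 - 3 = b by lia. lia.
have dp := dvdn_gcdl p q; have dq := dvdn_gcdr p q; set g := gcdn p q in dp dq *.
rewrite -(dvdn_addl _ (dvdn_mull (2 + 4 * a) dp)).
have -> : 12 + (2 + 4 * a) * p = 16 * p + (2 + 4 * a) * q by lia.
by rewrite dvdn_add // dvdn_mull.
Qed.

Lemma window_pair a : 1 < a -> a < k -> a * (a - 1) %| l.
Proof.
move=> a1 ak; apply: mul_window_dvd; try lia; last by apply: dv; lia.
have [b ->] : exists b, a = b.+1 by exists (a - 1); lia.
by rewrite subn1 coprimeSn.
Qed.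

(** Each product of two consecutive numbers divides [l], and the greatest common
divisor of the two products divides 12. *)
Lemma window_four : 4 < k -> (k - 1) * (k - 2) * ((k - 3) * (k - 4)) <= 12 * l.
Proof.
move=> k4; apply: dvdn_leq; first by lia.
have a2 : 2 < k - 1 by lia.
have := gcd_window a2; have ->: k - 1 - 1 = k - 2 by lia.
have ->: k - 1 - 2 = k - 3 by lia. have ->: k - 1 - 3 = k - 4 by lia.
have := window_pair (_ : 1 < k - 1) (_ : k - 1 < k); have := window_pair (_ : 1 < k - 3) (_ : k - 3 < k).
have ->: k - 1 - 1 = k - 2 by lia. have ->: k - 3 - 1 = k - 4 by lia.
move=> /(_ _ _)/[dup] h1 _ /(_ _ _)/[dup] h2 _ h3.
have {}h1 : (k - 3) * (k - 4) %| l by apply: h1; lia.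
have {}h2 : (k - 1) * (k - 2) %| l by apply: h2; lia.
by rewrite -muln_lcm_gcd mulnC; apply: dvdn_mul; rewrite // dvdn_lcm h1 h2.
Qed.

(** Fixed coprime factors suffice for [k <= 106]; beyond that the product of four
consecutive factors grows like the fourth power of [k]. *)
Lemma window_cube : 12 < k -> 8 * (k * k * k) <= l.
Proof.
move=> k12; case: (ltnP k 16) => h1.
  apply: leq_trans (window_ge13 k12); have : k * k * k <= 15 * 15 * 15 by do 2?apply: leq_mul; lia.
  lia.
case: (ltnP k 36) => h2.
  apply: leq_trans (window_ge16 h1); have : k * k * k <= 35 * 35 * 35 by do 2?apply: leq_mul; lia.
  lia.
case: (ltnP k 107) => h3.
  apply: leq_trans (window_ge20 (_ : 19 < k)); last by lia.
  have : k * k * k <= 106 * 106 * 106 by do 2?apply: leq_mul; lia.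
  lia.
have [m km] : exists m, k = m + 107 by exists (k - 107); lia.
have := window_four (_ : 4 < k); rewrite km => /(_ _) h.
have {}h : (m + 106) * (m + 105) * ((m + 104) * (m + 103)) <= 12 * l.
  have := h; have ->: m + 107 - 1 = m + 106 by lia. have ->: m + 107 - 2 = m + 105 by lia.
  have ->: m + 107 - 3 = m + 104 by lia. have ->: m + 107 - 4 = m + 103 by lia.
  by apply; lia.
have : 96 * ((m + 107) * (m + 107) * (m + 107)) <=
  (m + 106) * (m + 105) * ((m + 104) * (m + 103)) by nia.
lia.
Qed.

End Arith.

(** * The case k >= 8 *)

Section Large.
Variable T : finType.
Implicit Types (e : rel T) (S : {set T}).

(** What is left to choose is the radius of the balls: large enough to cover half
of the vertices, small enough for [periodic_of_diameter].  For [k = 8] this takes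
a better sparsity bound once the girth is 14 or more. *)
Lemma periodic_large l k d e (x0 : T) : 7 < k -> k != 10 -> k != 12 -> 0 < l ->
  0 < d -> degree_bound T k d -> outdeg_ge d e -> outdeg_ge d (rev_rel e) -> no_closed e l ->
  (forall j, 0 < j -> j < k -> j %| l) -> periodic k e.
Proof.
move=> k7 k10 k12 l0 d0 dn hd hd' nl dv; 
apply: (periodic_of_diameter x0 _ d0 dn hd nl dv); first by lia.
move=> g gg kg g2k.
have gk := girth_geW kg gg.
have dg p q D i : 0 < q -> p <= q ->
    (forall r : rel T, girth_ge g r -> sparse r p q) ->
    2 * (30 * k - 1) * (q - p) ^ i.+1 + 30 * k * k * p * q ^ i <
      2 * (30 * k - 1) * q ^ i.+1 -> D = 2 * i.+1 ->
    forall x y, exists2 j, j <= D & walk e j x y.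
  move=> q0 pq B lt ->; have k0 : 0 < k by lia.
  apply: diameter_of_half; first exact: half_reach_geometric q0 pq (B _ gg) hd dn k0 lt.
  exact: half_reach_geometric q0 pq (B _ (girth_ge_rev gg)) hd' dn k0 lt.
have : [|| k == 8, k == 9, k == 11 | 12 < k] by lia.
case/or4P=> [/eqP k8|/eqP k9|/eqP k11|kb].
- have := window_ge8 l0 dv k7; rewrite k8 in dg g2k kg * => lg.
  case: (ltnP g 14) => g14.
    exists 16; split; first by lia.
    apply: (dg 5 24 _ 7); [done|done|move=> r gr|idtac|done].
      by apply: (@sparse_even_girth T 2); apply: girth_geW kg gr.
    by lia.
  exists 14; split; first by lia.
  apply: (dg 1 7 _ 6); [done|done|move=> r gr|idtac|done].
    by apply: (@sparse_odd_girth T 5); apply: girth_geW gr; lia.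
  by lia.
- have := window_ge9 l0 dv; rewrite k9 in dg g2k kg * => /(_ isT) lg.
  exists 24; split; first by lia.
  apply: (dg 1 5 _ 11); [done|done|move=> r gr|idtac|done].
    by apply: (@sparse_odd_girth T 3); apply: girth_geW kg gr.
  by lia.
- have := window_ge10 l0 dv; rewrite k11 in dg g2k kg * => /(_ isT) lg.
  exists 36; split; first by lia.
  apply: (dg 1 6 _ 17); [done|done|move=> r gr|idtac|done].
    by apply: (@sparse_odd_girth T 4); apply: girth_geW kg gr.
  by lia.
exists (2 * (k * k)); split.
  apply: leq_trans (window_cube l0 dv kb); nia.
apply: diameter_of_half; first exact: half_reach_square dn gk hd.
by apply: half_reach_square dn (girth_ge_rev gk) hd'.
Qed.

End Large.

(** * The case k = 7 *)

Section Comb.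
Variable T : finType.
Implicit Types (e : rel T) (S : {set T}).

(** Decides whether [a * i + b * j = l] is solvable, by trying all [a]. *)
Definition combines l i j := has (fun a => (a * i <= l) && (j %| l - a * i)) (iota 0 l.+1).

Lemma no_closed_combines e l i j x : no_closed e l -> combines l i j ->
  walk e i x x -> ~~ walk e j x x.
Proof.
move=> nl /hasP[a _ /andP[le /dvdnP[b hb]]].
by apply: (@no_closed_comb T e l i j a b) => //; rewrite -hb subnKC.
Qed.

Lemma degree_bound_gt0 (x0 : T) k d : degree_bound T k d -> 0 < k -> 0 < d.
Proof.
have n0 : 0 < #|T| by apply/card_gt0P; exists x0.
rewrite /degree_bound; case: d => // + k0; rewrite muln0 leqn0 muln_eq0; lia.
Qed.

Lemma card_disjoint_bigcup_ge (g d : nat) (F : nat -> {set T}) :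
  (forall r, r < g -> d <= #|F r|) ->
  (forall r s x, r < g -> s < g -> x \in F r -> x \in F s -> r = s) ->
  g * d <= #|\bigcup_(r < g) F r|.
Proof.
move=> hF dis; rewrite -sum1_card partition_disjoint_bigcup /=; last first.
  move=> r s rs; rewrite -setI_eq0; apply: contraR rs => /set0Pn[x].
  rewrite inE => /andP[xr xs]; apply/eqP/val_inj.
  exact: dis (ltn_ord r) (ltn_ord s) xr xs.
rewrite -[g in X in X <= _]card_ord -sum_nat_const; apply: leq_sum => r _.
by rewrite sum1_card hF.
Qed.

End Comb.

Section Seven.
Variable T : finType.
Implicit Types (e : rel T) (S : {set T}).

Lemma no_closed60_girth e : no_closed e 60 -> girth_ge 7 e.
Proof.
by move=> nl [|[|[|[|[|[|[|j]]]]]]] x // _ _; apply: no_closed_dvd nl _.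
Qed.

(** [reach e 2] has girth at least four, and the ratio 5/14 for it does better than
one more step at ratio 1/4. *)
Lemma girth7_reach3 e d : 0 < d -> girth_ge 7 e -> outdeg_ge d e ->
  forall x, 67 * d <= 28 * #|outs (reach e 3) x|.
Proof.
move=> d0 g7 hd x.
have h1 y : d <= #|outs (reach e 1) y|.
  by apply: leq_trans (hd y) _; apply/subset_leq_card/subsetP=> z; rewrite !inE reach1.
have r1 : girth_ge 7 (reach e 1) by apply: girth_ge_reach g7.
have h2 y : (7 * d + 3) %/ 4 <= #|outs (reach e 2) y|.
  by have := reach_grow (isT : 1 <= 4) (@sparse_odd_girth T 2 _ r1) d0 h1 h1 y; rewrite add1n; lia.
have r2 : girth_ge 4 (reach e 2) by apply: girth_ge_reach g7.
by have := reach_grow (isT : 5 <= 14) (sparse_girth4 r2) d0 h1 h2 x; rewrite add1n; lia.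
Qed.

(** [reach e 3] has girth at least three. *)
Lemma girth7_reach6 e d : 0 < d -> girth_ge 7 e -> outdeg_ge d e ->
  forall x, 201 * d <= 56 * #|outs (reach e 6) x|.
Proof.
move=> d0 g7 hd x.
have h3 y : (67 * d + 27) %/ 28 <= #|outs (reach e 3) y|.
  by have := girth7_reach3 d0 g7 hd y; lia.
have r3 : girth_ge 3 (reach e 3) by apply: girth_ge_reach g7.
have h0 : 0 < (67 * d + 27) %/ 28 by lia.
have := reach_grow (isT : 1 <= 2) (sparse_girth3 r3) h0 h3 h3 x.
rewrite (_ : 3 + 3 = 6) //; lia.
Qed.

Lemma diameter_no_closed60 e d : 0 < d -> degree_bound T 7 d -> no_closed e 60 -> outdeg_ge d e ->
  outdeg_ge d (rev_rel e) -> forall x y, exists2 j, j <= 12 & walk e j x y.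
Proof.
move=> d0 dn nl hd hd'; have g7 := no_closed60_girth nl.
apply: (@diameter_of_half T e 6) => x.
  by have := girth7_reach6 d0 g7 hd x; move: dn; rewrite /degree_bound; lia.
by have := girth7_reach6 d0 (girth_ge_rev g7) hd' x; move: dn; rewrite /degree_bound; lia.
Qed.

Lemma diameter_girth9 e d : 0 < d -> degree_bound T 7 d -> girth_ge 9 e -> outdeg_ge d e ->
  outdeg_ge d (rev_rel e) -> forall x y, exists2 j, j <= 11 & walk e j x y.
Proof.
move=> d0 dn g9 hd hd' x y.
have h1 := reach_geometric 4 x d0 (isT : 0 < 5) (isT : 1 <= 5) (@sparse_odd_girth T 3 _ g9) hd.
have h2 := reach_geometric 5 y d0 (isT : 0 < 5) (isT : 1 <= 5) (@sparse_odd_girth T 3 _ (girth_ge_rev g9)) hd'.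
have [] := @reach_meet T e 5 6 x y.
  by move: dn h1 h2; rewrite /degree_bound; lia.
move=> a [b [z [ha hb wa wb]]]; exists (a + b); first by lia.
exact: walkD wa wb.
Qed.

(** An arc from a vertex [x] of a shortest closed walk closes up within 13 steps,
or 12 if the girth [g] is at least 9, and all lengths in this range above [g]
combine with [g] to 60.  So the arc lies on a closed walk of length [g], and its head is a
vertex like [x]; by connectivity all arcs are reached in this way. *)
Lemma arc_on_shortest e d (x0 : T) : 0 < d -> degree_bound T 7 d -> no_closed e 60 -> outdeg_ge d e ->
  outdeg_ge d (rev_rel e) ->
  exists g, [/\ g \in [:: 7; 8; 9; 11], exists x, walk e g x x &
    forall x y, e x y -> walk e g.-1 y x].
Proof.
move=> d0 dn nl hd hd'; have con := diameter_no_closed60 d0 dn nl hd hd'.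
have g7 := no_closed60_girth nl.
have con9 := diameter_girth9 d0 dn _ hd hd'.
have [|g [v gg [/andP[g0 g14] w]]] := @girth_attained T e 14.
  move=> g14; have [y xy] := walk_total 1 x0 d0 hd.
  have [j j12 w] := con y x0.
  have := g14 (1 + j) x0 isT (_ : 1 + j < 14); rewrite (walkD xy w) => h.
  by have := h j12.
have gs : g \in [:: 7; 8; 9; 11].
  have gl : g <= 6 \/ g = 10 \/ g = 12 \/ g = 13 \/ g \in [:: 7; 8; 9; 11] by rewrite !inE; lia.
  case: gl => [le|[E|[E|[E|//]]]].
  - by have := g7 g v g0 le; rewrite w.
  - by have := no_closed_dvd v nl (_ : g %| 60); rewrite w E => /(_ isT).
  - by have := no_closed_dvd v nl (_ : g %| 60); rewrite w E => /(_ isT).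
  have [y xy] := walk_total 1 x0 d0 hd.
  have g9 : 9 <= g by rewrite E.
  have [j j12 wj] := con9 (girth_geW g9 gg) y x0; have := gg (1 + j) x0 isT; rewrite (walkD xy wj) E => h.
  by have := h j12.
exists g; split => //; first by exists v.
have key x y : walk e g x x -> e x y -> walk e g.-1 y x.
  move=> wx xy; have x1y : walk e 1 x y by rewrite walk1.
  have [j jle wj] : exists2 j, j <= (if g <= 8 then 12 else 11) & walk e j y x.
    case: ifP => g8; first exact: con.
    by apply: con9; apply: girth_geW gg; lia.
  have wt := walkD x1y wj.
  have gj : g <= 1 + j.
    by rewrite leqNgt; apply/negP=> lt; have := gg (1 + j) x isT lt; rewrite wt.
  suff -> : g.-1 = j by [].
  have nc : ~~ combines 60 g (1 + j).
    by apply/negP=> cm; have := no_closed_combines nl cm wx; rewrite wt.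
  have : all (fun g => all (fun j => [|| 1 + j < g, (if g <= 8 then 12 else 11) < j,
      combines 60 g (1 + j) | g.-1 == j]) (iota 0 13)) [:: 7; 8; 9; 11] by vm_compute.
  have j13 : j \in iota 0 13 by rewrite mem_iota; move: jle; case: ifP; lia.
  move=> /allP/(_ g gs)/allP/(_ j j13).
  by rewrite ltnNge gj ltnNge jle (negbTE nc) => /eqP.
have all_on u : walk e g u u.
  have [j _ wj] := con v u; move: wj; elim: j v w => [|j IH] z wz; first by move=> /eqP <-.
  rewrite walkS => /existsP[y /andP[zy yu]]; apply: (IH y) => //.
  have -> : g = g.-1 + 1 by lia.
  by apply: walkD (key _ _ wz zy) _; rewrite walk1.
by move=> x y; apply: key.
Qed.

(** A vertex preceded by two different positions of the closed walk, at distance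
[D], would lie on closed walks of lengths [g + D] and [2 * g - D] through these
positions, and one of them combines with [g] to 60.  So the successors of
different positions are distinct. *)
Lemma closed_seq_fill e d g c : g \in [:: 7; 8; 9; 11] -> closed_seq g e c ->
  no_closed e 60 -> outdeg_ge d e -> (forall x y, e x y -> walk e g.-1 y x) ->
  g * d <= #|\bigcup_(r < g) outs e (c r)|.
Proof.
move=> gs C nl hd arc; have g0 : 0 < g by move: gs; rewrite !inE; lia.
apply: (@card_disjoint_bigcup_ge T g d (fun r => outs e (c r))) => [r _|r s x rg sg]; first exact: hd.
rewrite !inE => rx sx.
have wl i : walk e g (c i) (c i).
  by have := closed_seq_walk i g C; case: (C) => _ ->.
have wt u w : u < g -> w < g -> e (c u) x -> e (c w) x -> ~~ combines 60 g (g + (u + g - w) %% g).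
  move=> ug wg ux wx; apply/negP=> cm.
  have := no_closed_combines nl cm (wl u); rewrite (closed_seq_close g0 C ug wg) //.
  have -> : g = 1 + g.-1 by lia.
  by apply: walkD (arc _ _ wx); rewrite walk1.
(* One of the two totals always combines with g to 60; there are finitely many cases. *)
have h1 := wt r s rg sg rx sx; have h2 := wt s r sg rg sx rx.
have : all (fun h => all (fun r => all (fun s =>
   [|| r == s, combines 60 h (h + (r + h - s) %% h) | combines 60 h (h + (s + h - r) %% h)])
   (iota 0 h)) (iota 0 h)) [:: 7; 8; 9; 11] by vm_compute.
move=> /allP/(_ g gs)/allP/(_ r) h; have {h} := h (_ : r \in iota 0 g).
rewrite mem_iota rg => /(_ isT)/allP/(_ s) h; have {h} := h (_ : s \in iota 0 g).
rewrite mem_iota sg => /(_ isT).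
by rewrite (negbTE h1) (negbTE h2) !orbF => /eqP.
Qed.

(** The girth is 7, since larger values would need too many vertices in
[closed_seq_fill].  Fewer than [d] vertices have no predecessor on a fixed closed
walk of length 7, so every vertex [y] is reached from it in two steps, and likewise
returns to it in two.  Of the lengths that close up such walks only 7 is possible;
this gives [y] a position modulo 7 that increases by one along every arc. *)
Lemma periodic_seven e d : 0 < d -> degree_bound T 7 d -> no_closed e 60 -> outdeg_ge d e ->
  outdeg_ge d (rev_rel e) -> T -> periodic 7 e.
Proof.
move=> d0 dn nl hd hd' x0.
have [g [gs [v wv] arc]] := arc_on_shortest x0 d0 dn nl hd hd'.
have g0 : 0 < g by move: gs; rewrite !inE; lia.
have [c C _] := closed_seqP g0 wv.
have C' := closed_seq_rev g0 C.
have h1 := closed_seq_fill gs C nl hd arc.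
have h2 : g * d <= #|\bigcup_(r < g) outs (rev_rel e) (c (r * g.-1))|.
  apply: (closed_seq_fill gs C' (no_closed_rev nl) hd') => x y yx.
  by rewrite walk_rev; apply: arc.
have gE : g = 7.
  have := leq_trans h1 (max_card _); move: dn gs; rewrite /degree_bound !inE => dn.
  by move=> /or4P[] /eqP -> //; lia.
subst g.
have dg : #|T| < 7 * d + d by move: dn; rewrite /degree_bound; lia.
have meet (S U : {set T}) : 7 * d <= #|S| -> d <= #|U| -> exists2 x, x \in S & x \in U.
  move=> hS hU; have : S :&: U != set0.
    rewrite -card_gt0; have := cardsUI S U; have : #|S :|: U| <= #|T| := max_card _.
    lia.
  by case/set0Pn=> x; rewrite inE => /andP[]; exists x.
have fP y : exists r : 'I_7, walk e 2 (c r) y.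
  have [x /bigcupP[r _]] := meet _ _ h1 (hd' y); rewrite !inE => rx xy.
  by exists r; apply: (@walkD T e 1 1 _ x); rewrite walk1.
have hP y : exists s : 'I_7, walk e 2 y (c s).
  have [x /bigcupP[r _]] := meet _ _ h2 (hd y); rewrite !inE => rx yx.
  exists (Ordinal (ltn_pmod (r * 6) g0)); rewrite /= (closed_seq_mod _ C).
  by apply: (@walkD T e 1 1 _ x); rewrite walk1.
have close j (r s : 'I_7) y z : walk e 2 (c r) y -> walk e j y z -> walk e 2 z (c s) ->
    ~~ combines 60 7 (2 + j + 2 + (r + 7 - s) %% 7).
  move=> ry yz zs; apply/negP=> cm.
  have wr : walk e 7 (c r) (c r) by have := closed_seq_walk r 7 C; case: (C) => _ ->.
  have := no_closed_combines nl cm wr; rewrite (closed_seq_close _ C) //.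
  by apply: walkD zs; apply: walkD yz.
have [f fw] := fin_all_exists fP.
apply: (@periodic_label T 7 e f).
  by move=> u w; have [j _ wj] := diameter_no_closed60 d0 dn nl hd hd' u w; exists j.
move=> u w uw; have [s ws] := hP w.
have c1 := close 1 _ _ _ _ (fw u) (_ : walk e 1 u w) ws; rewrite walk1 in c1; move/(_ uw) in c1.
have c0 := close 0 _ _ _ _ (fw w) (eqxx w) ws.
move: c0 c1; case: (f u) (f w) s {ws} => [a a7] [b b7] [t t7] /=.
have : all (fun a => all (fun b => all (fun s =>
   [|| combines 60 7 (2 + 0 + 2 + (b + 7 - s) %% 7), combines 60 7 (2 + 1 + 2 + (a + 7 - s) %% 7) | b == a.+1 %[mod 7] ])
   (iota 0 7)) (iota 0 7)) (iota 0 7) by vm_compute.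
move=> /allP/(_ a); rewrite mem_iota => /(_ a7)/allP/(_ b); rewrite mem_iota => /(_ b7).
move=> /allP/(_ t); rewrite mem_iota => /(_ t7).
by move=> + c0 c1; rewrite (negbTE c0) (negbTE c1) => /eqP.
Qed.

End Seven.

(** * The case k = 5 without closed walks of length five *)

Section FiveA.
Variable T : finType.
Implicit Types (e : rel T) (S : {set T}).

Lemma girth7_reach4 e d : 0 < d -> girth_ge 7 e -> outdeg_ge d e ->
  forall x, 313 * d <= 112 * #|outs (reach e 4) x|.
Proof.
move=> d0 g7 hd x.
have h1 y : d <= #|outs (reach e 1) y|.
  by apply: leq_trans (hd y) _; apply/subset_leq_card/subsetP=> z; rewrite !inE reach1.
have r1 : girth_ge 7 (reach e 1) by apply: girth_ge_reach g7.
have h3 y : (67 * d + 27) %/ 28 <= #|outs (reach e 3) y|.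
  by have := girth7_reach3 d0 g7 hd y; lia.
have h0 : 0 < (67 * d + 27) %/ 28 by lia.
have := reach_grow (isT : 1 <= 4) (@sparse_odd_girth T 2 _ r1) h0 h3 h1 x.
by rewrite addn1; lia.
Qed.

(** Arcs that can be traversed in one step or in two. *)
Definition flexible e : rel T := fun x y => e x y && [exists h, e x h && e h y].

Lemma flexible_walk e i x y : walk (flexible e) i x y ->
  forall j, i <= j <= i.*2 -> walk e j x y.
Proof.
elim: i x => [|i IH] x; first by move=> w [].
rewrite walkS => /existsP[z /andP[/andP[xz /existsP[h /andP[xh hz]]] zy]] j ij.
case: (ltnP j i.*2.+2) => lt.
  have -> : j = 1 + j.-1 by lia.
  by apply: (@walkD T e 1 _ x z); rewrite ?walk1 //; apply: IH => //; lia.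
have -> : j = 1 + (1 + i.*2) by lia.
apply: (@walkD T e 1 _ x h); rewrite ?walk1 //.
apply: (@walkD T e 1 _ h z); rewrite ?walk1 //; apply: IH => //; lia.
Qed.

(** Let [X] be the set of successors of [v] and [Y] the set of vertices at distance
two.  Adding to the arcs inside [Y] the paths of length two through [X] keeps the
girth at least four, as the result is part of [reach e 2]; so some [z] in [Y] is
sparse in it.  If [z] has a successor in [X], all the successors of that vertex lie
in [Y] and are reached from [z], so [Y] is large.  Otherwise most successors of
[z] lie outside [X] and [Y]. *)
Lemma indep_reach3 e d v : 0 < d -> girth_ge 7 e -> outdeg_ge d e ->
  (forall u, e v u -> ~~ flexible e v u) ->
  37 * d <= 14 * #|outs (reach e 3) v|.
Proof.
move=> d0 g7 hd nf.
have ind u w : e v u -> e v w -> ~~ e u w.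
  move=> vu vw; apply/negP=> uw; have /negP := nf w vw; apply.
  by rewrite /flexible vw; apply/existsP; exists u; rewrite vu.
pose Y := outs (reach e 2) v :\: outs e v.
have NY u : e v u -> outs e u \subset Y.
  move=> vu; apply/subsetP=> w; rewrite !inE => uw.
  apply/andP; split; first by apply/negP=> vw; have := ind u w vu vw; rewrite uw.
  by apply/reachP; exists 2; split=> //; apply: (@walkD T e 1 1 _ u); rewrite walk1.
have [u] : exists u, e v u.
  have /card_gt0P[u] : 0 < #|outs e v| by apply: leq_trans (hd v).
  by rewrite inE; exists u.
move=> vu; have dY : d <= #|Y| := leq_trans (hd u) (subset_leq_card (NY u vu)).
have Y0 : Y != set0 by rewrite -card_gt0; apply: leq_trans dY.
(* Paths of length two through a successor of v count as arcs. *)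
pose rho : rel T := fun z w => e z w || [exists x, [&& e v x, e z x & e x w]].
have g4 : girth_ge 4 rho.
  apply: girth_ge_sub (girth_ge_reach (_ : (4 - 1) * 2 < 7) g7) => // z w /orP[zw|].
    by apply/reachP; exists 1; rewrite walk1.
  case/existsP=> x /and3P[_ zx xw]; apply/reachP; exists 2; split=> //.
  by apply: (@walkD T e 1 1 _ x); rewrite walk1.
have [z zY le] := sparse_girth4 g4 Y0.
have XY : #|outs e v :|: Y| = #|outs e v| + #|Y|.
  rewrite cardsU (_ : _ :&: _ = set0) ?cards0 ?subn0 //.
  by apply/setP=> w; rewrite !inE; case: (e v w).
have R3 : outs e v :|: Y \subset outs (reach e 3) v.
  apply/subsetP=> w; rewrite !inE => /orP[vw|/andP[_]]; last exact: reachW.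
  by apply/reachP; exists 1; rewrite walk1.
have hv := hd v.
case: (boolP [exists x, e v x && e z x]) => [/existsP[x /andP[vx zx]]|nx].
  have : outs e x \subset outs rho z :&: Y.
    apply/subsetP=> w xw; rewrite inE (subsetP (NY x vx) w xw) andbT !inE.
    by apply/orP; right; apply/existsP; exists x; rewrite vx zx; move: xw; rewrite inE.
  move/subset_leq_card; have := hd x; have := subset_leq_card R3; rewrite XY; lia.
have : outs e v :|: Y :|: (outs e z :\: Y) \subset outs (reach e 3) v.
  rewrite subUset R3; apply/subsetP=> w; rewrite !inE => /andP[_ zw].
  move: zY; rewrite !inE => /andP[_ vz]; rewrite -[3]addn1; apply: reachD vz _.
  by rewrite reach1.
move/subset_leq_card.
have -> : #|outs e v :|: Y :|: (outs e z :\: Y)| = #|outs e v :|: Y| + #|outs e z :\: Y|.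
  rewrite cardsU (_ : _ :&: _ = set0) ?cards0 ?subn0 //.
  apply/setP=> w; rewrite in_set0 in_setI in_setU in_setD; apply/negP.
  move=> /andP[/orP[vw|->] /andP[nY zw]] //; move: nx => /existsPn/(_ w).
  by move: vw zw; rewrite !inE => -> ->.
have := cardsID Y (outs e z); have := hd z.
have : #|outs e z :&: Y| <= #|outs rho z :&: Y|.
  by apply/subset_leq_card/setSI/subsetP=> w; rewrite !inE /rho => ->.
rewrite XY; lia.
Qed.

(** The girth is at least seven.  Five flexible arcs in a row can be traversed in any
number of steps from 5 to 10, so a walk of length at most 7 from their end to their
start, which exists by counting, extends to a closed walk of length 12.  Hence
some vertex is the tail of no flexible arc.  The successors of this vertex span no
arc, and [indep_reach3] places it on a closed walk of length at most 6. *)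
Lemma no_closed_five_absurd e d (x0 : T) : 0 < d -> degree_bound T 5 d -> no_closed e 12 -> no_closed e 5 ->
  outdeg_ge d e -> outdeg_ge d (rev_rel e) -> False.
Proof.
move=> d0 dn nl n5 hd hd'.
have g7 : girth_ge 7 e.
  by move=> [|[|[|[|[|[|[|j]]]]]]] x // _ _; apply: no_closed_dvd nl _.
have g7' := girth_ge_rev g7.
case: (boolP [forall x, [exists y, flexible e x y]]) => [/forallP all|].
  have hf : outdeg_ge 1 (flexible e).
    move=> x; have /existsP[y xy] := all x; rewrite card_gt0; apply/set0Pn; exists y.
    by rewrite inE.
  have [y w] := walk_total 5 x0 (ltn0Sn 0) hf.
  have [] := @reach_meet T e 4 3 y x0.
    have := girth7_reach4 d0 g7 hd y; have := girth7_reach3 d0 g7' hd' x0.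
    by move: dn; rewrite /degree_bound; lia.
  move=> a [b [z [ha hb wa wb]]].
  have /negP := nl x0; apply.
  (* The return walk has length 2 to 7, so 5 to 10 steps remain for the flexible arcs. *)
  have -> : 12 = (12 - (a + b)) + (a + b) by lia.
  by apply: walkD (flexible_walk w _) (walkD wa wb); lia.
case/forallPn=> v /existsPn nf.
have [] := @reach_meet T e 3 3 v v.
  have := indep_reach3 d0 g7 hd (fun u _ => nf u); have := girth7_reach3 d0 g7' hd' v.
  by move: dn; rewrite /degree_bound; lia.
move=> a [b [z [ha hb wa wb]]].
have /negP := g7 (a + b) v ltac:(lia) ltac:(lia); apply; exact: walkD wa wb.
Qed.

End FiveA.

(** * Patterns of labels *)

Section Masks.

(** Patterns on the five positions of a closed walk are listed explicitly, so that
statements about pairs of patterns can be decided by evaluation. *)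
Definition mask5 (f : nat -> bool) : bitseq := map f (iota 0 5).
Definition masks : seq bitseq :=
  let b := [:: false; true] in
  [seq x :: y | x <- b, y <- [seq x :: y | x <- b, y <- [seq x :: y | x <- b,
    y <- [seq [:: x; y] | x <- b, y <- b]]]].

Lemma mask5_in f : mask5 f \in masks.
Proof. by rewrite /mask5 /=; case: (f 0) (f 1) (f 2) (f 3) (f 4) => [] [] [] [] []. Qed.

Definition weight (A : bitseq) := count id A.
Arguments weight : simpl never.

(** The lengths excluded are the divisors of 12 and 7, which makes 12 together
with 5. *)
Definition allowed t := t \notin [:: 1; 2; 3; 4; 6; 7; 12].

(** [A] stands for the positions preceding a vertex [x], [B] for those following a
vertex [y], and [j] for the length of a walk from [x] to [y]: every pair of
positions closes up to a closed walk. *)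
Definition compat j (A B : bitseq) :=
  all (fun r => all (fun s => [&& nth false A r & nth false B s] ==>
    allowed (j + 2 + (r + 5 - s) %% 5)) (iota 0 5)) (iota 0 5).

Definition consec (A : bitseq) :=
  has (fun r => nth false A r && nth false A (r.+1 %% 5)) (iota 0 5).
Definition consec3 (A : bitseq) :=
  has (fun r => [&& nth false A r, nth false A (r.+1 %% 5) & nth false A (r.+2 %% 5)])
    (iota 0 5).

Definition forall2 (P : bitseq -> bitseq -> bool) := all (fun A => all (P A) masks) masks.

Lemma forall2P P f g : forall2 P -> P (mask5 f) (mask5 g).
Proof. by move=> /allP/(_ _ (mask5_in f))/allP/(_ _ (mask5_in g)). Qed.

Lemma compat_le1 : forall2 (fun A B => all (fun j => [&& 0 < weight A, 0 < weight B & compat j A B] ==>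
  (weight A == 1) && (weight B == 1)) [:: 0; 1]).
Proof. by vm_compute. Qed.

Lemma compat_two : forall2 (fun A B => [&& 0 < weight A, 0 < weight B & compat 2 A B] ==>
  (weight A < 3) && ~~ consec B).
Proof. by vm_compute. Qed.

Lemma compat_three_two : forall2 (fun A B => (2 < weight A) && (1 < weight B) ==>
  ~~ has (fun j => compat j A B) (iota 0 5)).
Proof. by vm_compute. Qed.

Lemma compat_six : forall2 (fun A B => (5 < weight A + weight B) ==>
  ~~ has (fun j => compat j A B) (iota 0 11)).
Proof. by vm_compute. Qed.

Lemma compat_triple : forall2 (fun A B =>
  [&& weight A == 3, 0 < weight B & has (fun j => compat j A B) (iota 0 5)]
   ==> consec3 A).
Proof. by vm_compute. Qed.

Lemma compat_consec : forall2 (fun A B =>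
  [&& consec3 A, weight B == 2 & has (fun j => compat j A B) (iota 0 11)]
   ==> consec B).
Proof. by vm_compute. Qed.

End Masks.

(** * No vertex has three labels *)

Section Labels.
Variable T : finType.
Implicit Types (e : rel T) (S : {set T}) (c : nat -> T).

(** What is left for [k = 5], after passing to a power of the digraph. *)
Record five e d c : Prop := Five {
  five_d : 0 < d;
  five_dense : degree_bound T 5 d;
  five_nl : no_closed e 12;
  five_out : outdeg_ge d e;
  five_in : outdeg_ge d (rev_rel e);
  five_cyc : closed_seq 5 e c }.

Lemma five_rev e d c : five e d c -> five (rev_rel e) d (fun i => c (i * 4)).
Proof.
case=> d0 dn nl hd hd' C.
by apply: (Five d0 dn (no_closed_rev nl) hd' hd); apply: (@closed_seq_rev T 5 e c).
Qed.

(** The positions preceding [x]; with [rev_rel e], those following [x]. *)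
Definition labels e c x := mask5 (fun r => e (c r) x).
Arguments labels : simpl never.

Lemma nth_mask5 f r : r < 5 -> nth false (mask5 f) r = f r.
Proof. by case: r => [|[|[|[|[|r]]]]]. Qed.

Definition heavy e c i := [set x | i < weight (labels e c x)].

Lemma five_close e d c j x y r s : five e d c -> r < 5 -> s < 5 ->
  e (c r) x -> walk e j x y -> e y (c s) -> allowed (j + 2 + (r + 5 - s) %% 5).
Proof.
move=> [_ _ nl _ _ C] r5 s5 rx xy ys.
have w5 : walk e 5 (c r) (c r) by have := closed_seq_walk r 5 C; case: (C) => _ ->.
have w2 : walk e (j + 2) (c r) (c s).
  have -> : j + 2 = 1 + (j + 1) by lia.
  by apply: (@walkD T e 1 _ _ x); last apply: walkD xy _; rewrite walk1.
have := closed_seq_close (isT : 0 < 5) C r5 s5 w2.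
set t := _ + _ %% _ => wc; apply/negP=> tin.
have : combines 12 5 t.
  by move: tin; rewrite !inE => /or4P[|||/or4P[]] /eqP ->.
by move/(no_closed_combines nl)/(_ w5)/negP; apply.
Qed.

Lemma compatP e d c j x y : five e d c -> walk e j x y ->
  compat j (labels e c x) (labels (rev_rel e) c y).
Proof.
move=> F xy; apply/allP=> r; rewrite mem_iota => /andP[_ r5]; apply/allP=> s.
rewrite mem_iota => /andP[_ s5]; apply/implyP; rewrite !nth_mask5 // => /andP[rx ys].
exact: five_close F r5 s5 rx xy ys.
Qed.

Lemma card_pred (P : pred T) : #|[set x | P x]| = \sum_x (P x : nat).
Proof.
by rewrite -sum1dep_card big_mkcond; apply: eq_bigr => x _; case: (P x).
Qed.

Lemma weightE e c x : weight (labels e c x) =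
  e (c 0) x + (e (c 1) x + (e (c 2) x + (e (c 3) x + e (c 4) x))).
Proof. by rewrite /weight /labels /= addn0. Qed.

Lemma weight_sum e d c : five e d c -> 5 * d <= \sum_x weight (labels e c x).
Proof.
move=> [_ _ _ hd _ _]; under eq_bigr do rewrite weightE.
rewrite !big_split /= -!card_outs.
have := hd (c 0); have := hd (c 1); have := hd (c 2); have := hd (c 3); have := hd (c 4).
lia.
Qed.

Lemma weight_layers e d c : five e d c -> (forall x, weight (labels e c x) <= 3) ->
  5 * d <= #|heavy e c 0| + #|heavy e c 1|
           + #|heavy e c 2|.
Proof.
move=> F h3; apply: leq_trans (weight_sum F) _; rewrite /heavy !card_pred -!big_split.
by apply: leq_sum => x _; move: (h3 x); case: (weight (labels e c x)) => [|[|[|[|w]]]].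
Qed.

Lemma five_gth e d c : five e d c -> girth_ge 5 e.
Proof.
by case=> _ _ nl _ _ _ [|[|[|[|[|j]]]]] x // _ _; apply: no_closed_dvd nl _.
Qed.

(** Balls of radius five contain more than half of the vertices. *)
Lemma five_con e d c : five e d c -> forall x y, exists2 j, j <= 10 & walk e j x y.
Proof.
move=> F; have g5 := five_gth F; case: F => d0 dn _ hd hd' _.
have lt : 2 * (30 * 5 - 1) * (24 - 7) ^ 5 + 30 * 5 * 5 * 7 * 24 ^ 4 <
    2 * (30 * 5 - 1) * 24 ^ 5 by lia.
apply: (@diameter_of_half T e 5).
  exact: (@half_reach_geometric T 7 24 5 d e 4 d0 isT isT (sparse_girth5 g5) hd dn isT lt).
exact: (@half_reach_geometric T 7 24 5 d _ 4 d0 isT isT (sparse_girth5 (girth_ge_rev g5)) hd' dn isT lt).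
Qed.

Lemma sub_out_closure e S : S \subset out_closure e S.
Proof. exact: subsetUl. Qed.

Lemma out_closure_neq0 e S : S != set0 -> out_closure e S != set0.
Proof.
rewrite -!card_gt0 => h; exact: leq_trans h (subset_leq_card (sub_out_closure e S)).
Qed.

Lemma subset_neq0 S (U : {set T}) : S \subset U -> S != set0 -> U != set0.
Proof. by move=> SU; rewrite -!card_gt0 => h; apply: leq_trans h (subset_leq_card SU). Qed.

Lemma five_out_closure e d c S : five e d c -> S != set0 -> 17 * #|S| + 24 * d <= 24 * #|out_closure e S|.
Proof.
move=> F S0; have g5 := five_gth F; case: F => _ _ _ hd _ _.
by have := out_closure_grow (isT : 7 <= 24) (sparse_girth5 g5) S0 (fun x _ => hd x).
Qed.

Lemma iter_out_closure e i S x : x \in iter i (out_closure e) S ->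
  exists2 z, z \in S & exists2 j, j <= i & walk e j z x.
Proof.
elim: i x => [|i IH] x; first by exists x => //; exists 0; rewrite //= eqxx.
rewrite iterS inE => /orP[/IH[z zS [j ji w]]|/bigcupP[y /IH[z zS [j ji w]]]].
  by exists z => //; exists j => //; lia.
rewrite inE => yx; exists z => //; exists (j + 1); first by lia.
by apply: walkD w _; rewrite walk1.
Qed.

(** Complements of balls around [S].  They grow as [i] decreases, just as balls grow
with the radius. *)
Definition far e S i := [set x | ~~ [exists y in S, [exists j : 'I_i.+1, walk e j x y]]].

Lemma farP e S i x : reflect (forall y j, y \in S -> j <= i -> ~~ walk e j x y) (x \in far e S i).
Proof.
rewrite inE; apply: (iffP idP) => [h y j yS ji|h]; last first.
  by apply/exists_inP=> -[y yS /existsP[j w]]; have := h y j yS (ltn_ord j); rewrite w.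
apply/negP=> w; move: h => /exists_inPn/(_ y yS)/existsPn/(_ (Ordinal (ji : j < i.+1))).
by rewrite w.
Qed.

Lemma far_out_closure e S i : out_closure e (far e S i.+1) \subset far e S i.
Proof.
apply/subsetP=> x; rewrite inE => /orP[/farP h|/bigcupP[z /farP h]].
  by apply/farP=> y j yS ji; apply: h => //; lia.
rewrite inE => zx; apply/farP=> y j yS ji; apply/negP=> w.
have /negP := h y j.+1 yS ji; apply; rewrite -add1n.
by apply: walkD w; rewrite walk1.
Qed.

Lemma far0 e S : #|S| + #|far e S 0| = #|T|.
Proof.
rewrite -(cardsC S); congr (_ + _); apply: eq_card => x; rewrite in_setC.
apply/farP/idP => [h|h y j yS]; first by apply/negP=> xS; have := h x 0 xS isT; rewrite /= eqxx.
by rewrite leqn0 => /eqP -> /=; apply: contra h => /eqP ->.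
Qed.

Lemma disj_card (S U : {set T}) : (forall x, x \in S -> x \in U -> False) ->
  #|S| + #|U| <= #|T|.
Proof.
move=> h; rewrite -cardsUI (_ : S :&: U = set0) ?cards0 ?addn0 ?max_card //.
by apply/setP=> x; rewrite !inE; apply/negP=> /andP[]; apply: h.
Qed.

Lemma meet_card (S U : {set T}) : #|T| < #|S| + #|U| -> exists2 x, x \in S & x \in U.
Proof.
move=> lt; have : ~~ [disjoint S & U].
  apply/negP=> dis; move: lt; rewrite ltnNge => /negP; apply.
  by apply: disj_card => x xS xU; rewrite (disjointFr dis xS) in xU.
by move/pred0Pn=> [x /andP[]]; exists x.
Qed.

Lemma five_sum_le5 e d c x y : five e d c ->
  weight (labels e c x) + weight (labels (rev_rel e) c y) <= 5.
Proof.
move=> F; rewrite leqNgt; apply/negP=> h; have [j j10 w] := five_con F x y.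
have /implyP := forall2P (fun r => e (c r) x) (fun r => rev_rel e (c r) y) compat_six.
move=> /(_ h)/hasP; apply; exists j; first by rewrite mem_iota.
exact: compatP F w.
Qed.

Lemma five_le1 e d c j x y : five e d c -> j <= 1 -> walk e j x y ->
  0 < weight (labels e c x) -> 0 < weight (labels (rev_rel e) c y) ->
  weight (labels e c x) = 1 /\ weight (labels (rev_rel e) c y) = 1.
Proof.
move=> F j1 w hx hy.
have /allP h := forall2P (fun r => e (c r) x) (fun r => rev_rel e (c r) y) compat_le1.
have /implyP h' : [&& 0 < weight (labels e c x), 0 < weight (labels (rev_rel e) c y) &
     compat j (labels e c x) (labels (rev_rel e) c y)] ==>
     (weight (labels e c x) == 1) && (weight (labels (rev_rel e) c y) == 1).
  by apply: h; rewrite !inE; lia.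
by have /andP[/eqP -> /eqP ->] := h' (introT and3P (And3 hx hy (compatP F w))).
Qed.

Lemma five_two e d c x y : five e d c -> walk e 2 x y -> 0 < weight (labels e c x) ->
  0 < weight (labels (rev_rel e) c y) ->
  (weight (labels e c x) < 3) && ~~ consec (labels (rev_rel e) c y).
Proof.
move=> F w hx hy.
have /implyP := forall2P (fun r => e (c r) x) (fun r => rev_rel e (c r) y) compat_two.
by apply; apply/and3P; split=> //; apply: compatP F w.
Qed.

Lemma five_three_two e d c j x y : five e d c -> j <= 4 -> walk e j x y ->
  2 < weight (labels e c x) -> 1 < weight (labels (rev_rel e) c y) -> False.
Proof.
move=> F j4 w hx hy.
have /implyP := forall2P (fun r => e (c r) x) (fun r => rev_rel e (c r) y) compat_three_two.
move=> /(_ (introT andP (conj hx hy)))/hasP; apply.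
by exists j; [rewrite mem_iota|apply: compatP F w].
Qed.

Lemma five_triple e d c j x y : five e d c -> j <= 4 -> walk e j x y ->
  weight (labels e c x) = 3 -> 0 < weight (labels (rev_rel e) c y) -> consec3 (labels e c x).
Proof.
move=> F j4 w hx hy.
have /implyP := forall2P (fun r => e (c r) x) (fun r => rev_rel e (c r) y) compat_triple.
apply; apply/and3P; split=> //; first exact/eqP.
by apply/hasP; exists j; [rewrite mem_iota|apply: compatP F w].
Qed.

Lemma five_consec e d c x y : five e d c ->
  consec3 (labels e c x) -> weight (labels (rev_rel e) c y) = 2 -> consec (labels (rev_rel e) c y).
Proof.
move=> F hx hy; have [j j10 w] := five_con F x y.
have /implyP := forall2P (fun r => e (c r) x) (fun r => rev_rel e (c r) y) compat_consec.
apply; apply/and3P; split=> //; first exact/eqP.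
by apply/hasP; exists j; [rewrite mem_iota|apply: compatP F w].
Qed.

Lemma five_reach4 e d c : five e d c -> forall x, 2565 * d <= 1000 * #|outs (reach e 4) x|.
Proof.
move=> F x; have g5 := five_gth F; case: F => d0 _ _ hd _ _.
have := reach_geometric 3 x d0 (isT : 0 < 24) (isT : 7 <= 24) (sparse_girth5 g5) hd; move: #|_| => a.
lia.
Qed.

Lemma weight_layers2 e d c : five e d c -> (forall x, weight (labels e c x) <= 2) ->
  5 * d <= #|heavy e c 0| + #|heavy e c 1|.
Proof.
move=> F h2; apply: leq_trans (weight_layers F _) _ => [x|]; first exact: leq_trans (h2 x) _.
rewrite (_ : heavy e c 2 = set0) ?cards0 ?addn0 //.
by apply/setP=> x; rewrite !inE ltnNge h2.
Qed.

Lemma weight_rev e d c x : five e d c ->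
  weight (labels (rev_rel e) (fun i => c (i * 4)) x) = weight (labels (rev_rel e) c x).
Proof.
move=> [_ _ _ _ _ C]; rewrite !weightE.
rewrite -(closed_seq_mod (2 * 4) C) -(closed_seq_mod (3 * 4) C) -(closed_seq_mod (4 * 4) C).
rewrite [2 * 4 %% 5](_ : _ = 3) // [3 * 4 %% 5](_ : _ = 2) // [4 * 4 %% 5](_ : _ = 1) //.
rewrite mul0n mul1n; lia.
Qed.

Lemma rev_layers2 e d c : five e d c -> (forall x, weight (labels (rev_rel e) c x) <= 2) ->
  5 * d <= #|heavy (rev_rel e) c 0| + #|heavy (rev_rel e) c 1|.
Proof.
move=> F h2; have := weight_layers2 (five_rev F).
rewrite (eq_card (B := heavy (rev_rel e) c 0)) => [|x]; last first.
  by rewrite !inE (weight_rev _ F).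
rewrite [X in _ -> _ <= _ + X](eq_card (B := heavy (rev_rel e) (fun i => c (i * 4)) 1)) => [|x].
  by apply=> x; rewrite (weight_rev _ F).
by rewrite !inE (weight_rev _ F).
Qed.

Lemma far_grow e d c S i : five e d c -> far e S i.+1 != set0 ->
  17 * #|far e S i.+1| + 24 * d <= 24 * #|far e S i|.
Proof.
move=> F h; apply: leq_trans (five_out_closure F h) _.
by rewrite leq_mul2l subset_leq_card // far_out_closure.
Qed.

Lemma heavy1_far e d c : five e d c ->
  heavy e c 1 \subset far e (heavy (rev_rel e) c 0) 1.
Proof.
move=> F; apply/subsetP=> x; rewrite inE => hx; apply/farP=> y j; rewrite inE => hy j1.
by apply/negP=> w; have [E _] := five_le1 F j1 w (ltnW hx) hy; rewrite E in hx.
Qed.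

Lemma heavy2_far e d c : five e d c ->
  heavy e c 2 \subset far e (heavy (rev_rel e) c 0) 2.
Proof.
move=> F; apply/subsetP=> x; rewrite inE => hx; apply/farP=> y j; rewrite inE => hy.
have hx0 : 0 < weight (labels e c x) by apply: leq_trans hx.
rewrite leq_eqVlt => /orP[/eqP ->|j1]; apply/negP=> w.
  by have /andP[] := five_two F w hx0 hy; rewrite ltnNge hx.
by have [E _] := five_le1 F (j1 : j <= 1) w hx0 hy; rewrite E in hx.
Qed.

Lemma heavyQ_far e d c : five e d c -> (forall y, weight (labels (rev_rel e) c y) <= 2) ->
  (exists x, consec3 (labels e c x)) ->
  heavy (rev_rel e) c 1 \subset far (rev_rel e) (heavy e c 0) 2.
Proof.
move=> F B2 [x0 cx]; apply/subsetP=> y; rewrite inE => hy; apply/farP=> x j.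
rewrite inE => hx; rewrite walk_rev leq_eqVlt => /orP[/eqP ->|j1]; apply/negP=> w.
  have /andP[_ /negP] := five_two F w hx (ltnW hy); apply.
  by apply: (five_consec F cx); apply/eqP; rewrite eqn_leq B2.
by have [_ E] := five_le1 F (j1 : j <= 1) w hx (ltnW hy); rewrite E in hy.
Qed.

(** The variables stand for the cardinals of the sets in the proof of [weight_le2]. *)
Lemma weight_le2_lp n d M Q2 L P2 P3 N0 N1 N2 F0 F1 F2 Z3 Z2 Z1 W : 0 < d ->
  n * (30 * 5 - 1) <= 30 * 5 * 5 * d ->
  5 * d <= M + Q2 -> 5 * d <= L + P2 + P3 -> M + N0 = n -> L + F0 = n ->
  P2 <= N1 -> P3 <= N2 -> Q2 <= F2 ->
  17 * N1 + 24 * d <= 24 * N0 -> 17 * N2 + 24 * d <= 24 * N1 ->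
  17 * F1 + 24 * d <= 24 * F0 -> 17 * F2 + 24 * d <= 24 * F1 ->
  17 * P3 + 24 * d <= 24 * Z1 -> 17 * Z1 + 24 * d <= 24 * Z2 ->
  17 * Z2 + 24 * d <= 24 * Z3 -> 17 * Q2 + 24 * d <= 24 * W -> Z3 + W <= n -> False.
Proof. lia. Qed.

(** Let [x0] have three labels.  No vertex then has more than two successors on the
closed walk, and a vertex with two labels is far from the set [M] of vertices with
a successor there.  At least [5 * d] arcs leave the closed walk and as many
enter it, while [n] is barely more than [5 * d]; a set [M] leaving out
that much must be made up for by a large set [Q] of vertices with two successors
on the closed walk.  The labels of [x0] are consecutive, as [x0] reaches [M] in few
steps; so the successor positions of the vertices of [Q] are consecutive as well,
and these vertices are in turn far from all vertices with a predecessor on the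
closed walk.  This forces many
vertices with three labels.  These cannot reach [Q] within four steps, and the
balls around the two sets would have to be disjoint, but they are too large. *)
Lemma weight_le2 e d c : five e d c -> forall x, weight (labels e c x) <= 2.
Proof.
move=> F x0; rewrite leqNgt; apply/negP=> w0.
have F' := five_rev F; set r := rev_rel e.
have B2 y : weight (labels r c y) <= 2.
  have : 3 + weight (labels r c y) <= 3 + 2.
    by apply: leq_trans (five_sum_le5 x0 y F); rewrite leq_add2r.
  by rewrite leq_add2l.
have hM := rev_layers2 F B2; rewrite -/r in hM.
have gr S : S != set0 -> 17 * #|S| + 24 * d <= 24 * #|out_closure e S| := five_out_closure F.
have gr' S : S != set0 -> 17 * #|S| + 24 * d <= 24 * #|out_closure r S| := five_out_closure F'.
have P1 := heavy1_far F; have P2 := heavy2_far F.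
have P3_0 : heavy e c 2 != set0 by apply/set0Pn; exists x0; rewrite inE.
have N2_0 := subset_neq0 P2 P3_0.
have N1_0 : far e (heavy r c 0) 1 != set0.
  by apply: (subset_neq0 P1); apply/set0Pn; exists x0; rewrite inE; apply: ltnW.
have [d0 dn _ _ _ _] := F.
have Q2_0 : heavy r c 1 != set0.
  rewrite -card_gt0; have := far_grow F N1_0; have := far0 e (heavy r c 0).
  move: dn hM; rewrite /degree_bound; clear -d0; lia.
have [q] := set0Pn _ Q2_0; rewrite inE => qQ.
have A3 x : weight (labels e c x) <= 3.
  have : weight (labels e c x) + 2 <= 3 + 2.
    by apply: leq_trans (five_sum_le5 x q F); rewrite leq_add2l.
  by rewrite leq_add2r.
have hL := weight_layers F A3.
have cons3 : consec3 (labels e c x0).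
  have [y] : exists2 y, y \in outs (reach e 4) x0 & y \in heavy r c 0.
    apply: meet_card; have := five_reach4 F x0.
    have : #|heavy r c 1| <= #|heavy r c 0|.
      by apply/subset_leq_card/subsetP=> y; rewrite !inE; apply: ltnW.
    by move: dn hM; rewrite /degree_bound; clear -d0; lia.
  rewrite !inE => /reachP[j [_ j4 w]] yM; apply: (five_triple F j4 w) => //.
  by apply/eqP; rewrite eqn_leq A3.
have QF := heavyQ_far F B2 (ex_intro _ x0 cons3).
have F2_0 := subset_neq0 QF Q2_0.
have F1_0 := subset_neq0 (far_out_closure _ _ _) (out_closure_neq0 r F2_0).
have Z1 := out_closure_neq0 e P3_0; have Z2 := out_closure_neq0 e Z1.
have dis : #|out_closure e (out_closure e (out_closure e (heavy e c 2)))|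
    + #|out_closure r (heavy r c 1)| <= #|T|.
  apply: disj_card => x xP xQ.
  have [p pP [i i3 wi]] := @iter_out_closure e 3 _ _ xP.
  have [z zQ [j j1 wj]] := @iter_out_closure r 1 _ _ xQ.
  rewrite walk_rev in wj; rewrite inE in pP; rewrite inE in zQ.
  exact: (five_three_two F (leq_add i3 j1) (walkD wi wj) pP zQ).
exact: (weight_le2_lp d0 dn hM hL (far0 e _) (far0 r _) (subset_leq_card P1)
  (subset_leq_card P2) (subset_leq_card QF) (far_grow F N1_0) (far_grow F N2_0)
  (far_grow F' F1_0) (far_grow F' F2_0) (gr _ P3_0) (gr _ Z1) (gr _ Z2) (gr' _ Q2_0) dis).
Qed.

End Labels.

(** * No vertex has two labels *)

Section Labels1.
Variable T : finType.
Implicit Types (e : rel T) (S : {set T}) (c : nat -> T).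

Lemma weight_le1_lp n d m l f0 N g0 N' i : 0 < d ->
  n * (30 * 5 - 1) <= 30 * 5 * 5 * d ->
  10 * d + f0 + g0 + 2 * i <= 2 * n + N + N' ->
  m + f0 = n -> l + g0 = n -> N + N' <= n + i ->
  17 * N + 24 * d <= 24 * f0 -> 17 * N' + 24 * d <= 24 * g0 -> False.
Proof. lia. Qed.

Lemma weight_le2_rev e d c : five e d c -> forall x, weight (labels (rev_rel e) c x) <= 2.
Proof. by move=> F x; have := weight_le2 (five_rev F) x; rewrite (weight_rev _ F). Qed.

Lemma weight_sum_rev e d c : five e d c -> 5 * d <= \sum_x weight (labels (rev_rel e) c x).
Proof.
move=> F; have := weight_sum (five_rev F).
by under eq_bigr do rewrite (weight_rev _ F).
Qed.

Lemma rev_layers1 e d c : five e d c -> heavy (rev_rel e) c 1 = set0 ->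
  5 * d <= #|heavy (rev_rel e) c 0|.
Proof. by move=> F h; have := rev_layers2 F (weight_le2_rev F); rewrite h cards0 addn0. Qed.

Lemma heavy1_far_rev e d c : five e d c ->
  heavy (rev_rel e) c 1 \subset far (rev_rel e) (heavy e c 0) 1.
Proof.
move=> F; apply/subsetP=> y; rewrite inE => hy; apply/farP=> x j; rewrite inE => hx j1.
by rewrite walk_rev; apply/negP=> w; have [_ E] := five_le1 F j1 w hx (ltnW hy); rewrite E in hy.
Qed.

(** [a] and [b] will count the labels of a vertex in the two directions, [X] and [Y]
are the sets without labels, and [N] and [N'] are remote from labelled vertices. *)
Lemma sum_budget d (a b : T -> nat) (X Y N N' : {set T}) :
  5 * d <= \sum_x a x -> 5 * d <= \sum_x b x ->
  (forall x, a x + b x + (x \in X) + (x \in Y) + (x \in N :&: N') + (x \in N :&: N')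
     <= 2 + (x \in N) + (x \in N')) ->
  10 * d + #|X| + #|Y| + 2 * #|N :&: N'| <= 2 * #|T| + #|N| + #|N'|.
Proof.
move=> h1 h2 h; have cs (S : {set T}) : #|S| = \sum_x (x \in S : nat).
  by rewrite -card_pred; apply: eq_card => x; rewrite inE.
have := @leq_sum T (index_enum T) xpredT _ _ (fun x _ => h x).
rewrite !big_split /= sum_nat_const -!cs cardT -cardE; lia.
Qed.

Lemma weight_count e d c (N := far e (heavy (rev_rel e) c 0) 1)
    (N' := far (rev_rel e) (heavy e c 0) 1) : five e d c ->
  10 * d + #|far e (heavy (rev_rel e) c 0) 0| + #|far (rev_rel e) (heavy e c 0) 0|
    + 2 * #|N :&: N'| <= 2 * #|T| + #|N| + #|N'|.
Proof.
move=> F; apply: (sum_budget (weight_sum F) (weight_sum_rev F)) => x.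
have f0 : (x \in far e (heavy (rev_rel e) c 0) 0) = (weight (labels (rev_rel e) c x) == 0).
  apply/farP/eqP => [h|h y j].
    apply/eqP; rewrite -leqn0 leqNgt; apply/negP=> h0.
    by have := h x 0 _ isT; rewrite inE h0 /= eqxx => /(_ isT).
  by rewrite inE => hy; rewrite leqn0 => /eqP ->; apply/negP=> /eqP E; rewrite -E h in hy.
have g0 : (x \in far (rev_rel e) (heavy e c 0) 0) = (weight (labels e c x) == 0).
  apply/farP/eqP => [h|h y j].
    apply/eqP; rewrite -leqn0 leqNgt; apply/negP=> h0.
    by have := h x 0 _ isT; rewrite inE h0 /= eqxx => /(_ isT).
  by rewrite inE => hy; rewrite leqn0 => /eqP ->; apply/negP=> /eqP E; rewrite -E h in hy.
have n0 : x \in N -> weight (labels (rev_rel e) c x) == 0.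
  by rewrite -f0 => xN; apply: subsetP (far_out_closure _ _ _) _ (subsetP (sub_out_closure _ _) _ xN).
have n0' : x \in N' -> weight (labels e c x) == 0.
  by rewrite -g0 => xN; apply: subsetP (far_out_closure _ _ _) _ (subsetP (sub_out_closure _ _) _ xN).
have a2 : 1 < weight (labels e c x) -> x \in N.
  by move=> h; apply: subsetP (heavy1_far F) _ _; rewrite inE.
have b2 : 1 < weight (labels (rev_rel e) c x) -> x \in N'.
  by move=> h; apply: subsetP (heavy1_far_rev F) _ _; rewrite inE.
have := weight_le2 F x; have := weight_le2_rev F x.
rewrite f0 g0 inE; move: n0 n0' a2 b2; case: (x \in N); case: (x \in N');
  move: (weight (labels e c x)) (weight (labels _ c x)) => [|[|[|a]]] [|[|[|b]]] //= h1' h2' h3 h4;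
  try (by have := h1' isT); try (by have := h2' isT); try (by have := h3 isT);
  by have := h4 isT.
Qed.

(** A vertex with two labels is remote from the vertices with a successor on the
closed walk, and a remote vertex has all its successors among the vertices without
one; so at least [d] vertices have no successor on the closed walk.  This excludes
that they all have at most one, since [n] is barely more than [5 * d].  The same
then holds with the directions exchanged, and the total of [10 * d] labels cannot
be accommodated. *)
Lemma weight_le1 e d c : five e d c -> forall x, weight (labels e c x) <= 1.
Proof.
move=> F x0; rewrite leqNgt; apply/negP=> w0; have [d0 dn _ _ _ _] := F.
have P0 : heavy e c 1 != set0 by apply/set0Pn; exists x0; rewrite inE.
have N0 := subset_neq0 (heavy1_far F) P0.
have g := far_grow F N0; have f0 := far0 e (heavy (rev_rel e) c 0).
have Q0 : heavy (rev_rel e) c 1 != set0.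
  apply/negP=> /eqP /(rev_layers1 F) h; move: dn; rewrite /degree_bound; clear -d0 h g f0; lia.
have N0' := subset_neq0 (heavy1_far_rev F) Q0.
apply: (weight_le1_lp d0 dn (weight_count F) f0 (far0 (rev_rel e) _) _ g (far_grow (five_rev F) N0')).
by rewrite -cardsUI leq_add2r max_card.
Qed.

Lemma weight_le1_rev e d c : five e d c -> forall x, weight (labels (rev_rel e) c x) <= 1.
Proof. by move=> F x; have := weight_le1 (five_rev F) x; rewrite (weight_rev _ F). Qed.

Lemma weight1_uniq e c r s x : closed_seq 5 e c -> weight (labels e c x) <= 1 ->
  e (c r) x -> e (c s) x -> r = s %[mod 5].
Proof.
move=> C; rewrite weightE -(closed_seq_mod r C) -(closed_seq_mod s C).
move: (r %% 5) (s %% 5) (ltn_pmod r (isT : 0 < 5)) (ltn_pmod s (isT : 0 < 5)).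
by move=> [|[|[|[|[|a]]]]] [|[|[|[|[|b]]]]] // _ _ + h1 h2; rewrite h1 h2; lia.
Qed.

End Labels1.

(** * Layers around a closed walk of length five *)

Section Classes.
Variables (T : finType) (e : rel T) (d : nat) (c : nat -> T).
Implicit Types (S : {set T}).
Hypothesis F : five e d c.

Lemma allowed_close j r s x y : e (c r) x -> walk e j x y -> e y (c s) ->
  allowed (j + 2 + (r %% 5 + 5 - s %% 5) %% 5).
Proof.
have [_ _ _ _ _ C] := F.
rewrite -(closed_seq_mod r C) -(closed_seq_mod s C) => rx w ys.
exact: (five_close F (ltn_pmod r (isT : 0 < 5)) (ltn_pmod s (isT : 0 < 5)) rx w ys).
Qed.

(** Together with the two lemmas that follow: the positions that close up a walk of
length 0, 1 or 2 between vertices next to the closed walk. *)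
Lemma close0 r s x : e (c r) x -> e x (c s) -> s = r + 2 %[mod 5].
Proof.
move=> rx xs; have := @allowed_close 0 r s x x rx (eqxx x) xs.
rewrite -(modnDml r 2) -(modn_mod s).
move: (r %% 5) (s %% 5) (ltn_pmod r (isT : 0 < 5)) (ltn_pmod s (isT : 0 < 5)).
by move=> [|[|[|[|[|a]]]]] [|[|[|[|[|b]]]]].
Qed.

Lemma close1 r s x y : e (c r) x -> e x y -> e y (c s) -> s = r + 3 %[mod 5].
Proof.
move=> rx xy ys; have := @allowed_close 1 r s x y rx _ ys; rewrite walk1 => /(_ xy).
rewrite -(modnDml r 3) -(modn_mod s).
move: (r %% 5) (s %% 5) (ltn_pmod r (isT : 0 < 5)) (ltn_pmod s (isT : 0 < 5)).
by move=> [|[|[|[|[|a]]]]] [|[|[|[|[|b]]]]].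
Qed.

Lemma close2 r s x z y : e (c r) x -> e x z -> e z y -> e y (c s) ->
  s = r + 4 %[mod 5] \/ s = r + 1 %[mod 5].
Proof.
move=> rx xz zy ys; have := @allowed_close 2 r s x y rx _ ys.
have -> : walk e 2 x y by apply: (@walkD T e 1 1 x z); rewrite walk1.
move=> /(_ isT).
rewrite -(modnDml r 4) -(modnDml r 1) -(modn_mod s).
move: (r %% 5) (s %% 5) (ltn_pmod r (isT : 0 < 5)) (ltn_pmod s (isT : 0 < 5)).
by move=> [|[|[|[|[|a]]]]] [|[|[|[|[|b]]]]] // *; by [left|right].
Qed.

(** Position [i + 1] of the closed walk and the vertices that can replace it. *)
Definition layer i := [set x | e (c i) x && e x (c (i + 2))].

(** By [close0] a vertex with a predecessor and a successor on the closed walk lies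
in a layer. *)
Definition core := heavy e c 0 :&: heavy (rev_rel e) c 0.

Lemma closed_seq_cong i j : i = j %[mod 5] -> c i = c j.
Proof. by have [_ _ _ _ _ C] := F => h; rewrite -(closed_seq_mod i C) h (closed_seq_mod j C). Qed.

Lemma layer_mod i j : i = j %[mod 5] -> layer i = layer j.
Proof.
move=> h; rewrite /layer (closed_seq_cong h) (@closed_seq_cong (i + 2) (j + 2)) //.
by rewrite -modnDml h modnDml.
Qed.

Lemma head_uniq r s x : e (c r) x -> e (c s) x -> r = s %[mod 5].
Proof. by apply: weight1_uniq (five_cyc F) (weight_le1 F x). Qed.

Lemma layer_uniq i j x : x \in layer i -> x \in layer j -> i = j %[mod 5].
Proof. by rewrite !inE => /andP[h _] /andP[h' _]; apply: head_uniq h h'. Qed.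

Lemma heavy0 (r : rel T) x : x \in heavy r c 0 -> exists i, r (c i) x.
Proof.
rewrite inE weightE; case E0: (r (c 0) x); first by exists 0.
case E1: (r (c 1) x); first by exists 1.
case E2: (r (c 2) x); first by exists 2.
case E3: (r (c 3) x); first by exists 3.
by case E4: (r (c 4) x); first by exists 4.
Qed.

Lemma core_layer x : x \in core -> exists i, x \in layer i.
Proof.
rewrite in_setI => /andP[/heavy0[i ix] /heavy0[j xj]]; exists i.
by rewrite inE ix -(closed_seq_cong (close0 ix xj)).
Qed.

Lemma card_head : 5 * d <= #|heavy e c 0|.
Proof.
have := weight_layers2 F (weight_le2 F); rewrite (_ : heavy e c 1 = set0) ?cards0 ?addn0 //.
by apply/setP=> x; rewrite !inE ltnNge (weight_le1 F).
Qed.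

Lemma card_tail : 5 * d <= #|heavy (rev_rel e) c 0|.
Proof.
apply: (rev_layers1 F); apply/setP=> x; rewrite !inE ltnNge.
by rewrite (weight_le1_rev F).
Qed.

Lemma core_big S : d <= #|S| -> 11 * d <= #|S :&: core| + 2 * #|T|.
Proof.
move=> hS; have h1 := card_head; have h2 := card_tail.
have := cardsID core S.
have : #|S :\: core| <= #|~: core| by apply/subset_leq_card/subsetP=> x; rewrite !inE => /andP[].
have := cardsC core; have := cardsUI (heavy e c 0) (heavy (rev_rel e) c 0).
have := max_card (heavy e c 0 :|: heavy (rev_rel e) c 0); rewrite -/core.
lia.
Qed.

Lemma layer_low i : 6 * d <= #|layer i| + #|T|.
Proof.
have [_ _ _ hd _ _] := F; have h2 := card_tail.
have := cardsC (heavy (rev_rel e) c 0); have := hd (c i).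
have : outs e (c i) \subset layer i :|: ~: heavy (rev_rel e) c 0.
  apply/subsetP=> x; rewrite in_setU in_setC !inE => ix; rewrite ix /=.
  case: posnP => [_|h]; rewrite ?orbT // orbF.
  have [j xj] : exists j, rev_rel e (c j) x by apply: heavy0; rewrite inE.
  by rewrite -(closed_seq_cong (close0 ix xj)).
move/subset_leq_card; have := cardsU (layer i) (~: heavy (rev_rel e) c 0).
lia.
Qed.

(** The other four layers are not small, by [layer_low]. *)
Lemma layer_high i : #|layer i| + 24 * d <= 5 * #|T|.
Proof.
have h : #|layer 0| + (#|layer 1| + (#|layer 2| + (#|layer 3| + #|layer 4|))) <= #|T|.
  rewrite /layer !card_pred -!big_split /= -sum1_card; apply: leq_sum => x _.
  apply: leq_trans (weight_le1 F x); rewrite weightE.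
  have le (b b' : bool) : (b && b' : nat) <= b by case: b b' => [] [].
  by do 4 (apply: leq_add; first exact: le); apply: le.
rewrite (@layer_mod i (i %% 5)) ?modn_mod //.
have := layer_low 0; have := layer_low 1; have := layer_low 2; have := layer_low 3; have := layer_low 4.
move: (i %% 5) (ltn_pmod i (isT : 0 < 5)) h => [|[|[|[|[|a]]]]] // _; lia.
Qed.

(** A layer has about [d] vertices, and so have the two subsets. *)
Lemma layer_meet i S (U : {set T}) : S \subset layer i -> U \subset layer i ->
  11 * d <= #|S| + 2 * #|T| -> 11 * d <= #|U| + 2 * #|T| ->
  exists2 x, x \in S & x \in U.
Proof.
have [d0 dn _ _ _ _] := F => Si Ui hS hU.
have := layer_high i; have := cardsUI S U.
have : #|S :|: U| <= #|layer i| by rewrite subset_leq_card // subUset Si Ui.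
move: dn; rewrite /degree_bound => dn h1 h2 h3.
have : 0 < #|S :&: U| by clear -d0 dn h1 h2 h3 hS hU; lia.
by case/card_gt0P=> x; rewrite inE => /andP[]; exists x.
Qed.

Lemma layer_arc i j x y : x \in layer i -> y \in layer j -> e x y -> j = i + 1 %[mod 5].
Proof.
rewrite !inE => /andP[ix _] /andP[_ yj] xy; have := close1 ix xy yj; lia.
Qed.

Definition succs u := outs e u :&: core.
Definition preds u := outs (rev_rel e) u :&: core.

Lemma in_succs u x : (x \in succs u) = e u x && (x \in core).
Proof. by rewrite in_setI inE. Qed.

Lemma in_preds u x : (x \in preds u) = e x u && (x \in core).
Proof. by rewrite in_setI inE. Qed.

Lemma succs_big u : 11 * d <= #|succs u| + 2 * #|T|.
Proof. by apply: core_big; have [_ _ _ hd _ _] := F. Qed.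

Lemma preds_big u : 11 * d <= #|preds u| + 2 * #|T|.
Proof. by apply: core_big; have [_ _ _ _ hd _] := F. Qed.

Lemma big_neq0 S : 11 * d <= #|S| + 2 * #|T| -> exists x, x \in S.
Proof.
have [d0 dn _ _ _ _] := F => h; apply/card_gt0P.
move: dn; rewrite /degree_bound; clear -d0 h; lia.
Qed.

Lemma succs_layer i x : x \in layer i -> succs x \subset layer (i + 1).
Proof.
move=> xi; apply/subsetP=> y; rewrite in_succs => /andP[xy /core_layer[j yj]].
by rewrite -(layer_mod (layer_arc xi yj xy)).
Qed.

Lemma preds_layer i x : x \in layer i -> preds x \subset layer (i + 4).
Proof.
move=> xi; apply/subsetP=> y; rewrite in_preds => /andP[yx /core_layer[j yj]].
have := layer_arc yj xi yx => h; rewrite (@layer_mod (i + 4) j) //; lia.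
Qed.

Lemma five_triangle x y z : e x y -> e y z -> e z x -> False.
Proof.
move=> xy yz zx; have := no_closed_dvd x (five_nl F) (isT : 3 %| 12); move/negP; apply.
by apply: (@walkD T e 1 2 _ y); rewrite ?walk1 //; apply: (@walkD T e 1 1 _ z); rewrite walk1.
Qed.

(** A core predecessor of [u] in layer [i] and a core successor in layer [j] leave
for [j - i] the values 2 and 4 by [close2].  If 4 occurs for [x] and [z], then the
core successors of [u] all lie in one layer with the core predecessors of [x], or
the core predecessors of [u] with the core successors of [z]; in both cases a
common element makes a triangle. *)
Lemma core_label u : exists t, preds u \subset layer (t + 4) /\ succs u \subset layer (t + 1).
Proof.
have pair x z i j : x \in preds u -> z \in succs u -> x \in layer i -> z \in layer j ->
    j = i + 2 %[mod 5] \/ j = i + 4 %[mod 5].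
  rewrite in_preds => /andP[xu _]; rewrite in_succs => /andP[uz _].
  rewrite !inE => /andP[ix _] /andP[_ zj].
  by have := close2 ix xu uz zj; lia.
have predsP x : x \in preds u -> exists i, x \in layer i.
  by rewrite in_preds => /andP[_ /core_layer].
have succsP x : x \in succs u -> exists i, x \in layer i.
  by rewrite in_succs => /andP[_ /core_layer].
have inS x y : y \in succs x -> e x y by rewrite in_succs => /andP[].
have inP x y : y \in preds x -> e y x by rewrite in_preds => /andP[].
have only2 x z i j : x \in preds u -> z \in succs u -> x \in layer i -> z \in layer j ->
    j = i + 2 %[mod 5].
  move=> xu uz xi zj; case: (pair x z i j xu uz xi zj) => // ji; exfalso.
  (* Excluding the difference 4, which would close a triangle. *)
  case: (boolP [exists x', (x' \in preds u) && (x' \in layer (i + 2))]).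
    case/existsP=> x' /andP[x'u x'i].
    have [] := @layer_meet (i + 4) (succs u) (preds x).
    - apply/subsetP=> z' z'u; have [j' zj'] := succsP _ z'u.
      have := pair _ _ _ _ xu z'u xi zj'; have := pair _ _ _ _ x'u z'u x'i zj' => h1 h2.
      by rewrite (@layer_mod (i + 4) j') //; lia.
    - exact: preds_layer.
    - exact: succs_big.
    - exact: preds_big.
    by move=> w /inS uw /inP wx; apply: five_triangle uw wx (inP _ _ xu).
  move=> /existsPn no; have [] := @layer_meet i (preds u) (succs z).
  - apply/subsetP=> x' x'u; have [i' xi'] := predsP _ x'u.
    have := pair _ _ _ _ x'u uz xi' zj => h.
    have := no x'; rewrite x'u /= => ni.
    rewrite (@layer_mod i i') //; case: h => h; last by lia.
    by move: ni; rewrite (@layer_mod (i + 2) i') ?xi' //; lia.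
  - by rewrite (@layer_mod i (j + 1)); [apply: succs_layer|lia].
  - exact: preds_big.
  - exact: succs_big.
  by move=> w /inP wu /inS zw; apply: five_triangle (inS _ _ uz) zw wu.
have [x xu] := big_neq0 (preds_big u); have [i xi] := predsP _ xu.
have [z zu] := big_neq0 (succs_big u); have [j zj] := succsP _ zu.
have ji := only2 _ _ _ _ xu zu xi zj.
exists (i + 1); split; apply/subsetP.
  move=> x' x'u; have [i' xi'] := predsP _ x'u.
  by have := only2 _ _ _ _ x'u zu xi' zj => h; rewrite (@layer_mod _ i') //; lia.
move=> z' z'u; have [j' zj'] := succsP _ z'u.
by have := only2 _ _ _ _ xu z'u xi zj' => h; rewrite (@layer_mod _ j') //; lia.
Qed.

(** If the label increases by [j >= 2] modulo 5 from [u] to [w], there is a walk of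
length [j]: follow core successors, which advance by one layer at a time, and meet
the core predecessors of [w].  An arc along which the label does not increase by
exactly one closes up with such a walk to length 3, 4, 6 or 12. *)
Lemma periodic_five : periodic 5 e.
Proof.
have [f fP] := fin_all_exists core_label.
have go : forall j u w, f w = f u + j + 2 %[mod 5] -> walk e (j + 2) u w.
  elim=> [|j IH] u w h.
    have [] := @layer_meet (f u + 1) (succs u) (preds w).
    - by have [_] := fP u.
    - by have [h' _] := fP w; rewrite (@layer_mod _ (f w + 4)) //; lia.
    - exact: succs_big.
    - exact: preds_big.
    move=> x; rewrite in_succs in_preds => /andP[ux _] /andP[xw _].
    by apply: (@walkD T e 1 1 _ x); rewrite walk1.
  have [z zu] := big_neq0 (succs_big u); have zc := subsetP (proj2 (fP u)) z zu.
  have [y yz] := big_neq0 (succs_big z).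
  have y1 := subsetP (succs_layer zc) y yz; have y2 := subsetP (proj2 (fP z)) y yz.
  have h' := layer_uniq y1 y2.
  rewrite -[j.+1]add1n -addnA; apply: (@walkD T e 1 _ _ z).
    by rewrite walk1; move: zu; rewrite in_succs => /andP[].
  by apply: IH; lia.
apply: (@periodic_label T 5 e f).
  move=> u w; exists (f w + 4 * f u + 3 + 2); apply: go; lia.
move=> u w uw.
(* The values 0, 1, 3 and 9 of j stand for the labels of w exceeding that of u
   by 3, 2, 0 and 4 modulo 5. *)
have bad j : j + 3 \in [:: 3; 4; 6; 12] -> f u <> f w + j + 2 %[mod 5].
  move=> hj h; have wj := go j w u h.
  have : walk e (j + 3) u u.
    by rewrite addn3 -addn2 -add1n; apply: (@walkD T e 1 _ _ w) wj; rewrite walk1.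
  apply/negP; apply: no_closed_dvd (five_nl F) _.
  by move: hj; rewrite !inE => /or4P[] /eqP ->.
have b0 := bad 0 isT; have b1 := bad 1 isT; have b3 := bad 3 isT; have b9 := bad 9 isT.
lia.
Qed.

End Classes.

(** * The smallest nondivisor *)

Lemma nondivisor_dvd l k j : 12 %| l -> smallest_nondivisor_gt2 l k ->
  0 < j -> j < k -> j %| l.
Proof.
move=> l12 [_ _ kmin] j0 jk; case: (ltnP 2 j) => j2; last first.
  by apply: dvdn_trans l12; case: j j0 j2 {jk} => [|[|[|j]]].
by apply/contraT => /(kmin j j2); rewrite leqNgt jk.
Qed.

(** The values 6, 10 and 12 are divisors of 12 or products of smaller coprime
numbers. *)
Lemma nondivisor_val l k : 12 %| l -> smallest_nondivisor_gt2 l k ->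
  [|| k == 5, k == 7 | [&& 7 < k, k != 10 & k != 12]].
Proof.
move=> l12 hk; have dv := nondivisor_dvd l12 hk; case: hk => k2 kl _.
have n12 j : j %| 12 -> k != j.
  by move=> j12; apply/eqP=> kj; move: kl; rewrite kj (dvdn_trans j12 l12).
have n10 : k != 10.
  apply/eqP=> kj; move: kl; rewrite kj (@Gauss_dvd 2 5) //.
  by rewrite dv ?kj // dv ?kj.
have := n12 3 isT; have := n12 4 isT; have := n12 6 isT; have := n12 12 isT.
by move: n10 k2; lia.
Qed.

Section Main.
Variable T : finType.
Implicit Types (e : rel T).

(** For [k = 5] and [k = 7] the length [l] itself is of no use.  A power of the
digraph replaces it by 12 or 60. *)
Lemma periodic_nondivisor l k d e (x0 : T) : 0 < l -> 12 %| l ->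
  smallest_nondivisor_gt2 l k -> degree_bound T k d -> outdeg_ge d e ->
  outdeg_ge d (rev_rel e) -> no_closed e l -> periodic k e.
Proof.
move=> l0 l12 hk dn hd hd' nl; have dv := nondivisor_dvd l12 hk.
have d0 : 0 < d by apply: (degree_bound_gt0 x0 dn); case: hk; lia.
have power L m : l = m * L -> [/\ outdeg_ge d (walk e m), outdeg_ge d (rev_rel (walk e m)) &
    no_closed (walk e m) L].
  move=> lE; have m0 : 0 < m by case: m lE l0 => // ->.
  by split; [apply: outdeg_ge_power|apply: indeg_ge_power|apply: no_closed_power; rewrite mulnC -lE].
case/or3P: (nondivisor_val l12 hk) => [/eqP kE|/eqP kE|/and3P[k7 k10 k12]].
- have /dvdnP[m lE] := l12; have [hm hm' nm] := power 12 m lE.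
  apply: (@periodic_power T k m); rewrite kE in dn *.
  case: (boolP [forall x, ~~ walk (walk e m) 5 x x]) => [/forallP n5|].
    by case: (no_closed_five_absurd x0 d0 dn nm n5 hm hm').
  case/forallPn=> x; rewrite negbK => /(closed_seqP (isT : 0 < 5))[c C _].
  exact: periodic_five (Five d0 dn nm hm hm' C).
- have l60 : 60 %| l by rewrite (@Gauss_dvd 12 5) // l12 dv ?kE.
  have /dvdnP[m lE] := l60; have [hm hm' nm] := power 60 m lE.
  by apply: (@periodic_power T k m); rewrite kE in dn *; apply: periodic_seven dn nm hm hm' x0.
exact: periodic_large x0 k7 k10 k12 l0 d0 dn hd hd' nl dv.
Qed.

Lemma bigminn_le m (f : T -> nat) v : \big[minn/m]_(x : T) f x <= f v.
Proof.
have := mem_index_enum v; elim: (index_enum T) => [//|a s IH].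
rewrite big_cons inE => /orP[/eqP <-|/IH]; first exact: geq_minl.
exact: leq_trans (geq_minr _ _).
Qed.

Lemma deg_semidegree e :
  outdeg_ge (min_semidegree e) e /\ outdeg_ge (min_semidegree e) (rev_rel e).
Proof.
split=> x.
  by apply: leq_trans (geq_minl _ _) _; apply: bigminn_le (outdegree e) x.
by apply: leq_trans (geq_minr _ _) _; apply: bigminn_le (indegree e) x.
Qed.

Lemma no_closed_of_path e l : ~ has_closed_walk e l -> no_closed e l.
Proof.
move=> h x; apply/negP=> /walk_path[p [hp sp lp]].
by apply: h; exists x, p.
Qed.

End Main.

Import Order.TTheory GRing.Theory Num.Theory.
Local Open Scope ring_scope.

Lemma degree_bound_rat (T : finType) (k d : nat) : (0 < k)%N ->
  #|T|%:R / k%:R * (1 - 1 / (30 * k%:R)) <= d%:R :> rat -> degree_bound T k d.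
Proof.
move=> k0 h; rewrite /degree_bound -(ler_nat rat) !natrM natrB; last by lia.
rewrite natrM.
have k0' : (k%:R : rat) != 0 by rewrite pnatr_eq0 -lt0n.
have -> : #|T|%:R * (30%:R * k%:R - 1%:R) =
   30%:R * k%:R * k%:R * (#|T|%:R / k%:R * (1 - 1 / (30 * k%:R))) :> rat.
  by field.
by apply: ler_wpM2l h; rewrite -!natrM ler0n.
Qed.

Theorem theorem1p5 (l k : nat) (l_gt0 : (0 < l)%N) (dvd12l : (12 %| l)%N)
    (hk : smallest_nondivisor_gt2 l k) :
  exists n0 : nat, forall (T : finType) (e : rel T),
    oriented e ->
    (n0 <= #|T|)%N ->
    (#|T|%:R / k%:R * (1 - 1 / (30 * k%:R)) <= (min_semidegree e)%:R :> rat) ->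
    ~ has_closed_walk e l ->
    homomorphic e (dicycle k).
Proof.
(* One vertex is enough for the degree bound to force arcs. *)
exists 1%N => T e _ /card_gt0P[x0 _] hd nl.
have k0 : (0 < k)%N by case: hk; lia.
apply: (homomorphic_periodic k0); have [h1 h2] := deg_semidegree e.
exact: (periodic_nondivisor x0 l_gt0 dvd12l hk (degree_bound_rat k0 hd) h1 h2 (no_closed_of_path nl)).
Qed.
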